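(* Suppose the data satisfy Assumptions (A1) and (A2) stated in the context. Then, to get an approximation of the value function $V$ of order $\eta$ by the method described in the context, the number of iterations is $O\!\left(\frac{-\log\eta}{\eta}\right)$ as $\eta\to0$, whence the number of arithmetic operations is $O\!\left(|\mathcal{M}|^{O(\frac{-\log\eta}{\eta})}\,n^3\right)$ as $\eta\to0$. Explicitly: let $\lambda\in[\lambda_1,\lambda_2)$ and $\epsilon>0$ be such that (i) $M^m_{t_0}[0]\ge\epsilon I$ for some $t_0>0$ and $m\in\mathcal{M}$, and (ii) $M_t^m[P_0]\in[\epsilon I,\lambda I]$ for all $m\in\mathcal{M}$, $t\ge0$, $P_0\in[\epsilon I,\lambda I]$. Then there exist constants $C>0$ and $\eta_0\in(0,1)$ such that for every precision $\eta\in(0,\eta_0]$ there are a time step $\tau>0$ and a number of iterations $N\ge1$ with $$N\le C\,\frac{-\log\eta}{\eta}$$ such that $$\big|V(x)-\{\tilde S_\tau\}^N[V^0](x)\big|\le\eta|x|^2\qquad\text{for all }x\in\mathbb{R}^n$$ for all $V^0(x)=\frac12x'P_0x$ with $P_0\in[\epsilon I,\lambda I]$; and consequently, in the cost model of the context, the number of arithmetic operations needed to compute $\{\tilde S_\tau\}^N[V^0]$ is $O\!\left(|\mathcal{M}|^{O(\frac{-\log\eta}{\eta})}\,n^3\right)$ as $\eta\to0$.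
   Context: Data: a finite set $\mathcal{M}=\{1,\dots,M\}$, a real $\gamma>0$, and for each $m\in\mathcal{M}$ matrices $A^m\in\mathbb{R}^{n\times n}$, $\sigma^m\in\mathbb{R}^{n\times k}$ and symmetric $D^m\in\mathbb{R}^{n\times n}$. Put $\Sigma^m:=\frac{1}{\gamma^2}\sigma^m(\sigma^m)'$ (prime denotes transpose). Assumption (A1): there are constants $c_A,c_\sigma,c_D>0$ such that for all $m\in\mathcal{M}$ and $x\in\mathbb{R}^n$: $x'A^mx\le -c_A|x|^2$; $|\sigma^m|\le c_\sigma$ (operator norm); $D^m$ is positive definite with $x'D^mx\le c_D|x|^2$; and $c_A^2>c_Dc_\sigma^2/\gamma^2$. Assumption (A2): there is $m_D>0$ with $x'D^mx\ge m_D|x|^2$ for all $x\in\mathbb{R}^n$, $m\in\mathcal{M}$, and $\frac{c_\sigma^2}{\gamma^2}m_D>\big(c_A-\sqrt{c_A^2-c_Dc_\sigma^2/\gamma^2}\big)^2$. Fix such constants and set $\lambda_1=\frac{\gamma^2\left(c_A-\sqrt{c_A^2-c_Dc_\sigma^2/\gamma^2}\right)}{c_\sigma^2}$, $\lambda_2=\sqrt{m_D\gamma^2/c_\sigma^2}$. Under (A1) and (A2), for each $\lambda\in[\lambda_1,\lambda_2)$ every sufficiently small $\epsilon>0$ satisfies (i) and (ii). Control problem: $\mathcal{W}$ is the set of measurable $w:[0,\infty)\to\mathbb{R}^k$ with $\int_0^T|w_t|^2dt<\infty$ for all $T<\infty$; $\mathcal{D}_\infty$ is the set of measurable $\mu:[0,\infty)\to\mathcal{M}$.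 Given $x,w,\mu$, the trajectory $\xi$ solves $\dot\xi_t=A^{\mu_t}\xi_t+\sigma^{\mu_t}w_t$, $\xi_0=x$. The value function is $$V(x)=\sup_{w\in\mathcal{W}}\sup_{\mu\in\mathcal{D}_\infty}\sup_{T>0}\int_0^T\tfrac12\xi_t'D^{\mu_t}\xi_t-\tfrac{\gamma^2}{2}|w_t|^2\,dt.$$ For $m\in\mathcal{M}$, $S^m_T[V^0](x)=\sup_{w\in\mathcal{W}}\left(\int_0^T\tfrac12\xi_t'D^{m}\xi_t-\tfrac{\gamma^2}{2}|w_t|^2\,dt+V^0(\xi_T)\right)$, where $\xi$ is driven by the constant control $\mu\equiv m$; and $\tilde S_\tau[V^0]=\sup_{m\in\mathcal{M}}S^m_\tau[V^0]$. Riccati flows: $\Phi_m(P)=(A^m)'P+PA^m+P\Sigma^mP+D^m$ on symmetric $n\times n$ matrices; $M^m_t[P_0]=P(t)$, where $P(\cdot)$ is the maximal solution of $\dot P=\Phi_m(P)$, $P(0)=P_0$. One has $S^m_t[\frac12x'P_0x]=\frac12x'M^m_t[P_0]x$ as long as the Riccati solution exists. The order $\le$ on symmetric matrices is the Loewner order and $[A,B]=\{P\text{ symmetric}:A\le P\le B\}$. Method and cost model: starting from $V^0(x)=\frac12x'P_0x$, the method performs $N$ iterations of $\tilde S_\tau$ without pruning and returns $\{\tilde S_\tau\}^N[V^0]$, the maximum of the $|\mathcal{M}|^N$ quadratic forms $\frac12x'M^{i_N}_\tau\cdots M^{i_1}_\tau[P_0]x$. Applying $\tilde S_\tau$ to one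 quadratic form means solving $|\mathcal{M}|$ Riccati equations, counted as $O(|\mathcal{M}|n^3)$ arithmetic operations, and the total cost of $N$ iterations is counted as $O(|\mathcal{M}|^Nn^3)$. *)

(* Defs.v *)
From HB Require Import structures.
From mathcomp Require Export all_boot all_order all_algebra.
From mathcomp Require Export all_classical all_reals all_analysis.
Set Implicit Arguments.
Unset Strict Implicit.
Unset Printing Implicit Defensive.
Import Order.TTheory GRing.Theory Num.Theory.
Import numFieldNormedType.Exports.
Local Open Scope classical_set_scope.
Local Open Scope ring_scope.

Section LinearAlgebra.
Context {R : realType}.

Definition qform n (P : 'M[R]_n) (x : 'cV[R]_n) : R := (x^T *m P *m x) 0 0.

(* The Euclidean norm; the library's norm on matrices is the sup norm. *)
Definition enorm n (x : 'cV[R]_n) : R := Num.sqrt (\sum_i x i 0 ^+ 2).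

(* The supremum is over a nonempty bounded set, so [sup] is meaningful. *)
Definition opnorm n k (B : 'M[R]_(n, k)) : R :=
  sup [set enorm (B *m w) | w in [set w : 'cV[R]_k | enorm w <= 1]].

Definition posdef n (P : 'M[R]_n) : Prop :=
  forall x : 'cV[R]_n, x != 0 -> 0 < qform P x.

Definition loewner_le n (P Q : 'M[R]_n) : Prop :=
  forall x : 'cV[R]_n, qform P x <= qform Q x.

Definition loewner_itv n (A B : 'M[R]_n) : set 'M[R]_n :=
  [set P | [/\ P \is symmetricmx, loewner_le A P & loewner_le P B]].

End LinearAlgebra.

(* The index set {1, ..., M} is represented by 'I_M. *)
Record lq_data (R : realType) (M n k : nat) := LQData {
  lq_gamma : R;
  lq_A : 'I_M -> 'M[R]_n;
  lq_sigma : 'I_M -> 'M[R]_(n, k);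
  lq_D : 'I_M -> 'M[R]_n;
  lq_gamma_gt0 : 0 < lq_gamma;
  lq_D_sym : forall m, lq_D m \is symmetricmx }.

Section Problem.
Context {R : realType} {M n k : nat} (S : lq_data R M n k).

Let gamma : R := lq_gamma S.
Let A := lq_A S.
Let sigma := lq_sigma S.
Let D := lq_D S.
Let leb := @lebesgue_measure R.

Definition lq_Sigma (m : 'I_M) : 'M[R]_n :=
  (gamma ^+ 2)^-1 *: (sigma m *m (sigma m)^T).

Definition assumption_A1 (cA cs cD : R) : Prop :=
  [/\ 0 < cA, 0 < cs, 0 < cD,
      forall m, [/\ forall x, qform (A m) x <= - cA * enorm x ^+ 2,
                    opnorm (sigma m) <= cs,
                    posdef (D m) &
                    forall x, qform (D m) x <= cD * enorm x ^+ 2] &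
      cA ^+ 2 > cD * cs ^+ 2 / gamma ^+ 2].

Definition assumption_A2 (cA cs cD mD : R) : Prop :=
  [/\ 0 < mD,
      forall m x, qform (D m) x >= mD * enorm x ^+ 2 &
      cs ^+ 2 / gamma ^+ 2 * mD >
        (cA - Num.sqrt (cA ^+ 2 - cD * cs ^+ 2 / gamma ^+ 2)) ^+ 2].

Definition lambda1 (cA cs cD : R) : R :=
  gamma ^+ 2 * (cA - Num.sqrt (cA ^+ 2 - cD * cs ^+ 2 / gamma ^+ 2))
  / cs ^+ 2.

Definition lambda2 (cs mD : R) : R := Num.sqrt (mD * gamma ^+ 2 / cs ^+ 2).

(* Controls and trajectories are total functions on R of which only the
   values on [0, +oo[ matter. *)
Definition disturbance (w : R -> 'cV[R]_k) : Prop :=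
  (forall i, measurable_fun (`[0%R, +oo[ : set R) (fun t : R => w t i 0 : R)) /\
  (forall T : R,
    (\int[leb]_(t in `[0%R, T]) (enorm (w t) ^+ 2)%:E < +oo)%E).

Definition switching (mu : R -> 'I_M) : Prop :=
  forall m, measurable ((`[0%R, +oo[ : set R) `&` mu @^-1` [set m]).

(* Since w is only locally square integrable, the ODE is understood in the
   sense of Caratheodory, i.e. in integral form. *)
Definition trajectory (x : 'cV[R]_n) (w : R -> 'cV[R]_k) (mu : R -> 'I_M)
    (xi : R -> 'cV[R]_n) : Prop :=
  let f t := A (mu t) *m xi t + sigma (mu t) *m w t in
  forall T : R, 0 <= T -> forall i,
    leb.-integrable `[0, T] (fun t => (f t i 0)%:E) /\
    xi T i 0 = x i 0 + \int[leb]_(t in `[0, T]) f t i 0.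

Definition running_payoff (w : R -> 'cV[R]_k) (mu : R -> 'I_M)
    (xi : R -> 'cV[R]_n) (T : R) : \bar R :=
  (\int[leb]_(t in `[0%R, T])
    (2^-1 * qform (D (mu t)) (xi t)
     - gamma ^+ 2 / 2 * enorm (w t) ^+ 2)%:E)%E.

Definition value (x : 'cV[R]_n) : \bar R :=
  ereal_sup [set J | exists w mu xi T,
    [/\ disturbance w, switching mu, trajectory x w mu xi, 0 < T &
        J = running_payoff w mu xi T]].

Definition semigroup (m : 'I_M) (T : R) (V0 : 'cV[R]_n -> \bar R)
    (x : 'cV[R]_n) : \bar R :=
  ereal_sup [set J | exists w xi,
    [/\ disturbance w, trajectory x w (fun=> m) xi &
        J = (running_payoff w (fun=> m) xi T + V0 (xi T))%E]].

Definition semigroup_sup (tau : R) (V0 : 'cV[R]_n -> \bar R)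
    (x : 'cV[R]_n) : \bar R :=
  ereal_sup [set semigroup m tau V0 x | m in [set: 'I_M]].

Definition riccati_field (m : 'I_M) (P : 'M[R]_n) : 'M[R]_n :=
  (A m)^T *m P + P *m A m + P *m lq_Sigma m *m P + D m.

(* Solution on [0, T[, T possibly infinite.  Right continuity at 0 and the
   equation on ]0, T[ yield the equation at 0 with a right derivative. *)
Definition riccati_solution (m : 'I_M) (P0 : 'M[R]_n) (T : \bar R)
    (P : R -> 'M[R]_n) : Prop :=
  [/\ (0 < T)%E,
      P 0 = P0,
      forall t : R, 0 <= t -> (t%:E < T)%E -> P t \is symmetricmx,
      forall i j, P t i j @[t --> 0^'+] --> P 0 i j &
      forall t : R, 0 < t -> (t%:E < T)%E ->
        forall i j,
          is_derive t 1 (fun s => P s i j) (riccati_field m (P t) i j)].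

Definition riccati_maximal (m : 'I_M) (P0 : 'M[R]_n) (T : \bar R)
    (P : R -> 'M[R]_n) : Prop :=
  riccati_solution m P0 T P /\
  forall T' P', riccati_solution m P0 T' P' ->
    (forall t : R, 0 <= t -> (t%:E < T)%E -> P' t = P t) -> (T' <= T)%E.

(* [riccati_flow m t P0 Q] : M^m_t[P0] is defined and equal to Q. *)
Definition riccati_flow (m : 'I_M) (t : R) (P0 Q : 'M[R]_n) : Prop :=
  exists T P, [/\ riccati_maximal m P0 T P, (t%:E < T)%E & P t = Q].

End Problem.

Definition quad {R : realType} n (P : 'M[R]_n) (x : 'cV[R]_n) : \bar R :=
  (2^-1 * qform P x)%:E.

(* [ops M n N] is the number of arithmetic operations charged for N iterations
   without pruning with M matrix triples in dimension n; the cost model only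
   fixes it up to a constant, uniform in M, n and N: O(M^N n^3). *)
Definition cost_model (R : realType) (ops : nat -> nat -> nat -> nat) : Prop :=
  exists2 c : R, 0 < c &
    forall M n N : nat, (ops M n N)%:R <= c * M%:R ^+ N * n%:R ^+ 3.

(* Main.v *)
(* Idea: completing the square along a trajectory turns every matrix path Y
   with Y' + Phi(Y) <= 0 (resp. = 0, Phi being the Riccati field of the active
   mode) into an upper bound for (resp. the exact value of) the payoff.

   Upper bound for V. If lambda' is slightly above lambda, then
   Phi_m(lambda' I) <= - delta I for all m. As Phi_m is convex, moving a
   quadratic form P of the N-th iterate towards lambda' I by a fraction theta
   yields a slack theta delta I, which pays both for the decay of theta at rate
   delta / lambda' and for the O(tau^2) cost per step of replacing a measurable
   switching by a constant one: on one step the switched flow is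
   P + int Phi_mu(P) + O(tau^2), and x'(int Phi_mu(P))x is at most
   tau max_m x' Phi_m(P) x. So theta relaxes from 1 to O(tau).

   Lower bound for V. Along the closed loop w = gamma^-2 sigma' P xi the payoff
   rate is at least (delta2 / 2) |xi|^2 because lambda < lambda2, hence the
   terminal form decays geometrically: with beta = delta2 / lambda, V is at
   least 1 - (1 + beta tau)^-N times each quadratic form of the N-th iterate.

   With tau proportional to eta and N tau of order - ln eta, both errors are
   at most eta |x|^2. *)

Require Import Defs.
From mathcomp Require Import all_boot all_order all_algebra.
From mathcomp Require Import all_classical all_reals all_analysis.
From mathcomp Require Import measurable_realfun ring lra.
Import Order.TTheory GRing.Theory Num.Theory.
Import numFieldNormedType.Exports.
Local Open Scope classical_set_scope.
Local Open Scope ring_scope.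
Set Implicit Arguments.
Unset Strict Implicit.
Unset Printing Implicit Defensive.

(** * Absolutely continuous functions *)

(** The relaxation must aim at some [lambda'] strictly above [lambda]: at [lambda = lambda1] the
    bound on the Riccati field of [lambda I] that follows from (A1) is exactly 0 and leaves no
    slack. Beyond [lambda1] that bound, a parabola in the scalar, is negative up to its second root,
    and (A2) puts [lambda] to the left of the vertex, so there is room.

    No dynamic programming principle for V enters: both bounds are proved along individual
    trajectories, step by step. The obstacle for the upper bound is that a measurable switching may
    visit every mode within one step. The comparison path therefore follows the integral of the
    field frozen at P, and the single mode that replaces the switching is chosen for the state at
    the start of the step; this is admissible because the iterate is a pointwise maximum.

    As disturbances are only locally square integrable, the chain rule along trajectories rests on a
    product rule for integral functions. *)

Section AbsolutelyContinuous.
Context {R : realType}.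
Notation leb := (@lebesgue_measure R).

(** Absolute continuity with the density carried along. It has the shape of [trajectory], and the
    calculus rules act on pairs, so differentiation almost everywhere never appears. *)
Definition ac (a b : R) (f f' : R -> R) : Prop :=
  leb.-integrable `[a, b] (EFin \o f') /\
  forall t, a <= t <= b -> f t = f a + \int[leb]_(s in `[a, t]) f' s.

Lemma integrable_itvS (a b u v : R) (f : R -> R) : a <= u -> v <= b ->
  leb.-integrable `[a, b] (EFin \o f) -> leb.-integrable `[u, v] (EFin \o f).
Proof.
move=> au vb; apply: integrableS => //.
by apply: subset_itv; rewrite bnd_simp.
Qed.

Lemma Rintegral_chasles (a b c : R) (f : R -> R) : a <= b -> b <= c ->
  leb.-integrable `[a, c] (EFin \o f) ->
  \int[leb]_(s in `[a, c]) f s =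
  \int[leb]_(s in `[a, b]) f s + \int[leb]_(s in `[b, c]) f s.
Proof.
move=> ab bc intf.
have := @Rintegral_itvB R f (BLeft a) (BRight c) b intf.
rewrite !bnd_simp => /(_ ab bc).
rewrite Rintegral_itv_obnd_cbnd; first by move=> <-; rewrite addrC subrK.
apply: integrableS intf => //.
by apply: subset_itv; rewrite bnd_simp.
Qed.

Lemma ac_diff (a b u v : R) (f f' : R -> R) : ac a b f f' ->
  a <= u -> u <= v -> v <= b -> f v - f u = \int[leb]_(s in `[u, v]) f' s.
Proof.
move=> [intf fE] au uv vb.
rewrite (fE v) ?(fE u) ?au ?vb ?(le_trans au uv) ?(le_trans uv vb)//.
rewrite (@Rintegral_chasles a u v f')//; first by ring.
exact: integrable_itvS intf.
Qed.

Lemma acS (a b u v : R) (f f' : R -> R) : ac a b f f' ->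
  a <= u -> v <= b -> ac u v f f'.
Proof.
move=> acf au vb; split; first exact: integrable_itvS au vb acf.1.
move=> t /andP[ut tv]; by rewrite -(ac_diff acf au ut (le_trans tv vb)); ring.
Qed.

Lemma eq_ac (a b : R) (f g f' g' : R -> R) :
  (forall t, a <= t <= b -> f t = g t) ->
  (forall t, a <= t <= b -> f' t = g' t) -> ac a b f f' -> ac a b g g'.
Proof.
move=> fg fg' [intf fE]; split.
  apply: eq_integrable intf => // t; rewrite inE /= in_itv /= => tab.
  by rewrite fg'.
move=> t /andP[aT tb]; rewrite -!fg ?lexx ?aT ?(le_trans aT tb)//.
rewrite fE ?aT ?tb//; congr (_ + _); apply: eq_Rintegral => s.
rewrite inE /= in_itv /= => /andP[sa st].
by rewrite fg'// sa (le_trans st tb).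
Qed.

Lemma ac_continuous (a b : R) (f f' : R -> R) : a <= b -> ac a b f f' ->
  {within `[a, b], continuous f}.
Proof.
move=> ab [intf fE].
have cI := parameterized_integral_continuous ab intf.
apply: (@subspace_eq_continuous _ _ _ (fun t => f a +
   parameterized_integral leb a t f')).
  by move=> t; rewrite inE /= in_itv /= => tab; rewrite -(fE _ tab).
move=> t; apply: cvgD; [exact: cvg_cst|exact: cI].
Qed.

Lemma continuous_itv_bounded (a b : R) (f : R -> R) :
  {within `[a, b], continuous f} ->
  exists2 m, 0 <= m & forall t, a <= t <= b -> `|f t| <= m.
Proof.
move=> cf; have [ab|ba] := leP a b; last first.
  exists 0 => // t /andP[aT tb].
  by move: (le_trans aT tb); rewrite leNgt ba.
have [M1 _ M1E] := EVT_max ab cf; have [M2 _ M2E] := EVT_min ab cf.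
exists (`|f M1| + `|f M2|) => [|t tab]; first by rewrite addr_ge0.
have tI : t \in `[a, b] by rewrite in_itv.
rewrite ler_norml; apply/andP; split.
  rewrite lerNl; apply: le_trans (_ : - f M2 <= _); first by rewrite lerN2 M2E.
  by rewrite (le_trans (ler_norm _))// normrN lerDr.
by rewrite (le_trans (M1E t tI))// (le_trans (ler_norm _))// lerDl.
Qed.

Lemma continuous_itv_measurable (a b : R) (f : R -> R) :
  {within `[a, b], continuous f} -> measurable_fun `[a, b] f.
Proof. by move=> cf; apply: subspace_continuous_measurable_fun. Qed.

Lemma ac_bounded (a b : R) (f f' : R -> R) : ac a b f f' ->
  exists2 m, 0 <= m & forall t, a <= t <= b -> `|f t| <= m.
Proof.
move=> acf; have [ab|ba] := leP a b.
  by apply: continuous_itv_bounded; apply: ac_continuous acf.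
exists 0 => // t /andP[aT tb].
by move: (le_trans aT tb); rewrite leNgt ba.
Qed.

Lemma ac_measurable (a b : R) (f f' : R -> R) : ac a b f f' ->
  measurable_fun `[a, b] f.
Proof.
move=> acf; have [ab|ba] := leP a b.
  by apply: continuous_itv_measurable; apply: ac_continuous acf.
rewrite set_itv_ge ?bnd_simp -?ltNge//; exact: measurable_fun_set0.
Qed.

Lemma bounded_mul_integrable (a b m : R) (f g : R -> R) :
  leb.-integrable `[a, b] (EFin \o f) -> measurable_fun `[a, b] g ->
  (forall t, a <= t <= b -> `|g t| <= m) ->
  leb.-integrable `[a, b] (EFin \o (fun t => f t * g t)).
Proof.
move=> intf mg gm.
have mf : measurable_fun `[a, b] f.
  by apply/measurable_EFinP; exact: measurable_int intf.
have ifm : leb.-integrable `[a, b] (fun t => m%:E * (EFin \o f) t)%E.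
  exact: integrableZl.
apply: le_integrable ifm => //.
  by apply/measurable_EFinP; exact: measurable_funM.
move=> t tab; rewrite /= lee_fin !normrM mulrC ler_wpM2r//.
by rewrite (le_trans (gm t _))// ?ler_norm//; move: tab; rewrite /= in_itv.
Qed.

Lemma bounded_integrable (a b m : R) (g : R -> R) :
  measurable_fun `[a, b] g -> (forall t, a <= t <= b -> `|g t| <= m) ->
  leb.-integrable `[a, b] (EFin \o g).
Proof.
move=> mg gm; rewrite (_ : g = fun t => cst 1 t * g t); last first.
  by apply/funext => t; rewrite mul1r.
apply: bounded_mul_integrable gm => //.
apply: continuous_compact_integrable; first exact: segment_compact.
by move=> t; exact: cvg_cst.
Qed.

Lemma ac_cst (a b c : R) : ac a b (fun=> c) (fun=> 0).
Proof.
split; last by move=> t _; rewrite Rintegral_cst// mul0r addr0.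
exact: integrable0.
Qed.

Lemma acD (a b : R) (f f' g g' : R -> R) : ac a b f f' -> ac a b g g' ->
  ac a b (fun t => f t + g t) (fun t => f' t + g' t).
Proof.
move=> acf acg; split; first exact: (integrableD _ acf.1 acg.1).
move=> t /andP[aT tb].
rewrite RintegralD//; [|exact: integrable_itvS acf.1|exact: integrable_itvS acg.1].
by rewrite (acf.2 t) ?(acg.2 t) ?aT ?tb//; ring.
Qed.

Lemma acZ (a b c : R) (f f' : R -> R) : ac a b f f' ->
  ac a b (fun t => c * f t) (fun t => c * f' t).
Proof.
move=> acf; split; first exact: (integrableZl _ _ acf.1).
move=> t /andP[aT tb].
rewrite RintegralZl//; last exact: integrable_itvS acf.1.
by rewrite (acf.2 t) ?aT ?tb//; ring.
Qed.

Lemma ac_sum (a b : R) (I : finType) (f f' : I -> R -> R) :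
  (forall i, ac a b (f i) (f' i)) ->
  ac a b (fun t => \sum_i f i t) (fun t => \sum_i f' i t).
Proof.
move=> acf; elim: (index_enum I) => [|i s IH].
  by apply: eq_ac (ac_cst a b 0) => t _; rewrite big_nil.
by apply: eq_ac (acD (acf i) IH) => t _; rewrite big_cons.
Qed.

End AbsolutelyContinuous.

Section ProductRule.
Context {R : realType}.
Notation leb := (@lebesgue_measure R).

(* Both sides are the integral of f'(s) g'(t) over the triangle
   a <= s <= t <= b, computed in the two possible orders. *)
Lemma Rintegral_triangle (a b : R) (f g : R -> R) :
  leb.-integrable `[a, b] (EFin \o f) -> leb.-integrable `[a, b] (EFin \o g) ->
  \int[leb]_(s in `[a, b]) (f s * \int[leb]_(t in `[s, b]) g t) =
  \int[leb]_(t in `[a, b]) (g t * \int[leb]_(s in `[a, t]) f s).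
Proof.
move=> intf intg.
pose F := f \_ `[a, b]; pose G := g \_ `[a, b].
have intF : leb.-integrable setT (EFin \o F).
  by rewrite /F -restrict_EFin; apply/integrable_restrict => //; rewrite setTI.
have intG : leb.-integrable setT (EFin \o G).
  by rewrite /G -restrict_EFin; apply/integrable_restrict => //; rewrite setTI.
have mF : measurable_fun setT F by apply/measurable_EFinP; apply: measurable_int intF.
have mG : measurable_fun setT G by apply/measurable_EFinP; apply: measurable_int intG.
pose T : set (R * R) := [set z | z.1 <= z.2].
have mT : measurable T.
  have := @measurable_fun_ler _ (R * R)%type R setT fst snd
    measurable_fst measurable_snd.
  move=> /(_ measurableT [set true]); rewrite setTI; apply.
  by [].
pose h (z : R * R) : R := F z.1 * G z.2 * \1_T z.
have mh : measurable_fun setT h.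
  apply: measurable_funM; last exact: measurable_indic.
  apply: measurable_funM.
    by apply: measurableT_comp => //; exact: measurable_fst.
  by apply: measurableT_comp => //; exact: measurable_snd.
have iG s : leb.-integrable setT (fun t => (G t * \1_T (s, t))%:E).
  have mI : measurable_fun setT (fun t => \1_T (s, t) : R).
    apply: measurableT_comp; first exact: measurable_indic.
    exact: pair1_measurable.
  apply: le_integrable intG => //.
    by apply/measurable_EFinP; exact: measurable_funM.
  move=> t _ /=; rewrite lee_fin normrM ler_piMr// indicE.
  by case: (_ \in _); rewrite ?normr1 ?normr0.
have iF t : leb.-integrable setT (fun s => (F s * \1_T (s, t))%:E).
  have mI : measurable_fun setT (fun s => \1_T (s, t) : R).
    apply: measurableT_comp; first exact: measurable_indic.
    exact: pair2_measurable.
  apply: le_integrable intF => //.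
    by apply/measurable_EFinP; exact: measurable_funM.
  move=> s _ /=; rewrite lee_fin normrM ler_piMr// indicE.
  by case: (_ \in _); rewrite ?normr1 ?normr0.
(* The indicator is at most 1, so the iterated integral of [|h|] is at most the product of the L1
   norms of [F] and [G]. *)
have ih : (leb \x leb)%E.-integrable setT (EFin \o h).
  apply/integrable12ltyP; first exact/measurable_EFinP.
  have aG : (\int[leb]_t `|G t|%:E < +oo)%E.
    by have /integrableP[_] := intG.
  have aF : (\int[leb]_t `|F t|%:E < +oo)%E.
    by have /integrableP[_] := intF.
  have aGf : (\int[leb]_t `|G t|%:E)%E \is a fin_num.
    by rewrite ge0_fin_numE// integral_ge0.
  apply: (@le_lt_trans _ _ (\int[leb]_s (`|F s|%:E * \int[leb]_t `|G t|%:E))%E).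
    apply: ge0_le_integral => //.
    - by move=> s _; apply: integral_ge0.
    - apply: (@measurable_fun_fubini_tonelli_F _ _ _ _ _ leb
        (abse \o (EFin \o h))) => //; last by move=> z; exact: abse_ge0.
      by apply: measurableT_comp => //; exact/measurable_EFinP.
    - apply: emeasurable_funM => //.
      by apply/measurable_EFinP; exact: measurableT_comp.
    move=> s _; rewrite -ge0_integralZl//.
    - apply: ge0_le_integral => //.
      + apply: measurableT_comp => //; apply/measurable_EFinP.
        by apply: measurableT_comp => //; exact: pair1_measurable.
      + apply/measurable_EFinP; apply: measurable_funM => //.
        exact: measurableT_comp.
      + move=> t _ /=; rewrite -EFinM lee_fin !normrM ler_piMr//.
        by rewrite indicE; case: (_ \in _); rewrite ?normr1 ?normr0.
    - by apply/measurable_EFinP; exact: measurableT_comp.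
  rewrite -(fineK aGf) ge0_integralZr//; last 2 first.
    by apply/measurable_EFinP; exact: measurableT_comp.
    by rewrite lee_fin fine_ge0// integral_ge0.
  have aFf : (\int[leb]_t `|F t|%:E)%E \is a fin_num.
    by rewrite ge0_fin_numE// integral_ge0.
  by rewrite -(fineK aFf) -EFinM ltry.
have E1 s : (\int[leb]_t (EFin \o h) (s, t))%E =
    (F s * \int[leb]_t (G t * \1_T (s, t)))%:E.
  under eq_integral do rewrite /h /= -mulrA EFinM.
  rewrite integralZl//.
  rewrite EFinM /Rintegral fineK//.
  exact: (integrable_fin_num _ (iG s)).
have E2 t : (\int[leb]_s (EFin \o h) (s, t))%E =
    (G t * \int[leb]_s (F s * \1_T (s, t)))%:E.
  under eq_integral do rewrite /h /= (mulrC (F _)) -mulrA EFinM.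
  rewrite integralZl//.
  rewrite EFinM /Rintegral fineK//.
  exact: (integrable_fin_num _ (iF t)).
have indT s t : \1_T (s, t) = (s <= t)%R%:R :> R.
  by rewrite indicE; congr ((nat_of_bool _)%:R); apply/idP/idP; rewrite inE.
have := Fubini ih.
under eq_integral do rewrite E1.
under [RHS]eq_integral do rewrite E2.
move=> /(congr1 fine); rewrite -!/(Rintegral _ _ _) => FE.
rewrite Rintegral_mkcond [RHS]Rintegral_mkcond.
have -> : (fun s => f s * \int[leb]_(t in `[s, b]) g t) \_ `[a, b] =
    fun s => F s * \int[leb]_t (G t * \1_T (s, t)).
  apply/funext => s; rewrite /F !patchE; case: ifPn => [|_]; last by rewrite mul0r.
  rewrite inE /= in_itv /= => /andP[sa sb]; congr (_ * _).
  rewrite Rintegral_mkcond; apply: eq_Rintegral => t _.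
  rewrite /G !patchE indT !mem_setE /= !in_itv /=.
  have [st|ts] := leP s t; rewrite /= ?mulr0 ?mulr1//.
  by rewrite (le_trans sa st).
have -> // : (fun t => g t * \int[leb]_(s in `[a, t]) f s) \_ `[a, b] =
    fun t => G t * \int[leb]_s (F s * \1_T (s, t)).
apply/funext => t; rewrite /G !patchE; case: ifPn => [|_]; last by rewrite mul0r.
rewrite inE /= in_itv /= => /andP[sa sb]; congr (_ * _).
rewrite Rintegral_mkcond; apply: eq_Rintegral => s _.
rewrite /F !patchE indT !mem_setE /= !in_itv /=.
have [st|ts] := leP s t; rewrite /= ?mulr0 ?mulr1 ?andbT ?andbF//.
by rewrite (le_trans st sb) andbT.
Qed.

End ProductRule.

Section MatrixPaths.
Context {R : realType}.
Notation leb := (@lebesgue_measure R).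

(** Integration by parts: once the inner integrals of [Rintegral_triangle] are written as
    increments, the integral of [f' (g t - g)] equals that of [g' (f - f a)], and rearranging gives
    the product rule. *)
Lemma acM (a b : R) (f f' g g' : R -> R) : ac a b f f' -> ac a b g g' ->
  ac a b (fun t => f t * g t) (fun t => f' t * g t + f t * g' t).
Proof.
move=> acf acg.
have [mf _ fm] := ac_bounded acf; have [mg _ gm] := ac_bounded acg.
have i1 := bounded_mul_integrable acf.1 (ac_measurable acg) gm.
have i2 := bounded_mul_integrable acg.1 (ac_measurable acf) fm.
have i2' : leb.-integrable `[a, b] (EFin \o (fun t => f t * g' t)).
  by rewrite (_ : (fun t => f t * g' t) = fun t => g' t * f t)//; apply/funext => t; rewrite mulrC.
split; first exact: (integrableD _ i1 i2').
move=> t /andP[aT tb].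
have acft := acS acf (lexx a) tb; have acgt := acS acg (lexx a) tb.
have := Rintegral_triangle acft.1 acgt.1.
have -> : \int[leb]_(s in `[a, t]) (f' s * \int[leb]_(u in `[s, t]) g' u) =
    \int[leb]_(s in `[a, t]) (f' s * g t - f' s * g s).
  apply: eq_Rintegral => s; rewrite inE /= in_itv /= => /andP[sa st].
  by rewrite -(ac_diff acgt sa st)// mulrBr.
have -> : \int[leb]_(s in `[a, t]) (g' s * \int[leb]_(u in `[a, s]) f' u) =
    \int[leb]_(s in `[a, t]) (f s * g' s - g' s * f a).
  apply: eq_Rintegral => s; rewrite inE /= in_itv /= => /andP[sa st].
  by rewrite -(ac_diff acft (lexx a) sa)// mulrBr mulrC.
rewrite !RintegralB//; last 4 first.
- exact: integrable_itvS i2'.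
- exact: (integrableZr _ _ acgt.1).
- exact: (integrableZr _ _ acft.1).
- exact: integrable_itvS i1.
rewrite !RintegralZr//; [|exact: acgt.1|exact: acft.1].
rewrite RintegralD//; [|exact: integrable_itvS i1|exact: integrable_itvS i2'].
rewrite -(ac_diff acft (lexx a) aT (lexx t)) -(ac_diff acgt (lexx a) aT (lexx t)).
set I := \int[leb]_(s in _) _; set J := \int[leb]_(s in _) _; lra.
Qed.

Lemma ac_FTC (a b : R) (f f' : R -> R) :
  (forall t, a <= t <= b -> {for t, continuous f}) ->
  (forall t, a <= t <= b -> {for t, continuous f'}) ->
  (forall t, a < t < b -> is_derive t 1 f (f' t)) ->
  ac a b f f'.
Proof.
move=> cf cf' df.
have cin : {in `[a, b]%classic, continuous f'}.
  by move=> t; rewrite inE /= in_itv /=; exact: cf'.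
split.
  apply: continuous_compact_integrable; first exact: segment_compact.
  exact: continuous_in_subspaceT.
move=> t /andP[]; rewrite le_eqVlt => /predU1P[<- _|aT tb].
  by rewrite set_itv1 Rintegral_set1 addr0.
rewrite /Rintegral (@continuous_FTC2 R f' f a t)//=.
- by rewrite /=; lra.
- apply: continuous_in_subspaceT => s; rewrite inE /= in_itv /= => /andP[sa st].
  by apply: cf'; rewrite sa (le_trans st tb).
- split.
  + move=> s; rewrite in_itv /= => /andP[sa st].
    by have [|? _] := df s; [rewrite sa (lt_le_trans st tb)|].
  + by apply: cvg_at_right_filter; apply: cf; rewrite lexx (le_trans (ltW aT)).
  + by apply: cvg_at_left_filter; apply: cf; rewrite tb (ltW aT).
- move=> s; rewrite in_itv /= => /andP[sa st]; rewrite derive1E.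
  by apply: derive_val; apply: df; rewrite sa (lt_le_trans st tb).
Qed.

Definition mac p q (a b : R) (X X' : R -> 'M[R]_(p, q)) : Prop :=
  forall i j, ac a b (fun t => X t i j) (fun t => X' t i j).

Lemma macS p q (a b u v : R) (X X' : R -> 'M[R]_(p, q)) :
  mac a b X X' -> a <= u -> v <= b -> mac u v X X'.
Proof. by move=> macX au vb i j; apply: acS (macX i j) au vb. Qed.

Lemma macM p q r (a b : R) (X X' : R -> 'M[R]_(p, q)) (Y Y' : R -> 'M[R]_(q, r)) :
  mac a b X X' -> mac a b Y Y' ->
  mac a b (fun t => X t *m Y t) (fun t => X' t *m Y t + X t *m Y' t).
Proof.
move=> macX macY i j.
apply: eq_ac (ac_sum (fun k => acM (macX i k) (macY k j))) => t _.
  by rewrite mxE.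
by rewrite !mxE -big_split.
Qed.

Lemma mac_tr p q (a b : R) (X X' : R -> 'M[R]_(p, q)) :
  mac a b X X' -> mac a b (fun t => (X t)^T) (fun t => (X' t)^T).
Proof. by move=> macX i j; apply: eq_ac (macX j i) => t _; rewrite mxE. Qed.

Lemma macD p q (a b : R) (X X' Y Y' : R -> 'M[R]_(p, q)) :
  mac a b X X' -> mac a b Y Y' ->
  mac a b (fun t => X t + Y t) (fun t => X' t + Y' t).
Proof.
by move=> macX macY i j; apply: eq_ac (acD (macX i j) (macY i j)) => t _; rewrite mxE.
Qed.

Lemma mac_cst p q (a b : R) (X : 'M[R]_(p, q)) : mac a b (fun=> X) (fun=> 0).
Proof. by move=> i j; apply: eq_ac (ac_cst a b (X i j)) => t _; rewrite ?mxE. Qed.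

Lemma macZ p q (a b c : R) (X X' : R -> 'M[R]_(p, q)) :
  mac a b X X' -> mac a b (fun t => c *: X t) (fun t => c *: X' t).
Proof. by move=> macX i j; apply: eq_ac (acZ c (macX i j)) => t _; rewrite !mxE. Qed.

Lemma mac_qform n (a b : R) (Y Y' : R -> 'M[R]_n) (x x' : R -> 'cV[R]_n) :
  mac a b Y Y' -> mac a b x x' ->
  ac a b (fun t => qform (Y t) (x t)) (fun t => qform (Y' t) (x t) +
    (((x' t)^T *m Y t *m x t) 0 0 + ((x t)^T *m Y t *m x' t) 0 0)).
Proof.
move=> macY macx.
apply: eq_ac (macM (macM (mac_tr macx) macY) macx 0 0) => t _ //.
by rewrite /qform mulmxDl !mxE; ring.
Qed.

End MatrixPaths.

(** * Linear differential equations with measurable coefficients *)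

Section LinearODE.
Context {R : realType} {n : nat} (B : R -> 'M[R]_n) (b : R) (x : 'cV[R]_n).
Notation leb := (@lebesgue_measure R).
Hypothesis mB : forall i j, measurable_fun (`[0, +oo[ : set R) (fun t => B t i j : R).
Hypothesis Bb : forall t i j, 0 <= t -> `|B t i j| <= b.

(** The start is 0 rather than [x]: the increments then telescope to the iterates themselves, and
    the first increment is the constant [x]. *)
Fixpoint picard (k : nat) (t : R) : 'cV[R]_n :=
  if k is k'.+1
  then \col_i (x i 0 + \int[leb]_(s in `[0, t]) (B s *m picard k' s) i 0)
  else 0.

Lemma mulmx_bound (p : nat) (C : 'M[R]_(n, p)) t m i j : 0 <= t ->
  (forall k, `|C k j| <= m) -> `|(B t *m C) i j| <= n%:R * b * m.
Proof.
move=> t0 ym; rewrite mxE (le_trans (ler_norm_sum _ _ _))//.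
rewrite (@le_trans _ _ (\sum_(k < n) b * m))//.
  by apply: ler_sum => k _; rewrite normrM ler_pM// ?Bb.
by rewrite sumr_const card_ord -[leLHS]mulr_natl mulrA.
Qed.

Lemma measurable_mulmx (y : R -> 'cV[R]_n) (T : R) i :
  (forall j, measurable_fun (`[0, T] : set R) (fun t => y t j 0 : R)) ->
  measurable_fun (`[0, T] : set R) (fun t => (B t *m y t) i 0 : R).
Proof.
move=> my; rewrite (_ : (fun t => _) = fun t => \sum_j B t i j * y t j 0); last first.
  by apply/funext => t; rewrite mxE.
apply: measurable_sum => j; apply: measurable_funM => //.
apply: measurable_funS (mB i j) => //.
by apply: subset_itvl; rewrite bnd_simp.
Qed.

Lemma integrable_mulmx (y : R -> 'cV[R]_n) (T m : R) i :
  (forall j, measurable_fun (`[0, T] : set R) (fun t => y t j 0 : R)) ->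
  (forall t j, 0 <= t <= T -> `|y t j 0| <= m) ->
  leb.-integrable `[0, T] (EFin \o (fun t => (B t *m y t) i 0)).
Proof.
move=> my ym; apply: (@bounded_integrable R 0 T (n%:R * b * m)).
  exact: measurable_mulmx.
move=> t /andP[t0 tT]; apply: mulmx_bound => // j.
by rewrite ym// t0.
Qed.

Lemma picard_measurable_bounded k (T : R) :
  (forall j, measurable_fun (`[0, T] : set R) (fun t => picard k t j 0 : R)) /\
  exists m, forall t j, 0 <= t <= T -> `|picard k t j 0| <= m.
Proof.
elim: k => [|k [IHm [m IHb]]].
  split=> [j|].
    rewrite [X in measurable_fun _ X](_ : _ = cst 0)//.
    by apply/funext => t; rewrite mxE.
  by exists 0 => t j _; rewrite mxE normr0.
have ack j : ac 0 T (fun t => picard k.+1 t j 0) (fun t => (B t *m picard k t) j 0).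
  split; first exact: integrable_mulmx IHm IHb.
  move=> t _; rewrite !mxE set_itv1 Rintegral_set1 addr0.
  by congr (_ + _); apply: eq_Rintegral => s _; rewrite mxE.
split; first by move=> j; exact: ac_measurable (ack j).
have /choice[f fP] : forall j, exists m,
    forall t, 0 <= t <= T -> `|picard k.+1 t j 0| <= m.
  by move=> j; have [m' _ m'P] := ac_bounded (ack j); exists m'.
exists (\sum_j `|f j|) => t j tT.
rewrite (le_trans (fP j t tT))// (bigD1 j)//= (le_trans (ler_norm _))// lerDl.
by apply: sumr_ge0.
Qed.

Lemma picard_integrable k (T : R) i :
  leb.-integrable `[0, T] (EFin \o (fun t => (B t *m picard k t) i 0)).
Proof.
have [mp [m pm]] := picard_measurable_bounded k T.
exact: integrable_mulmx mp pm.
Qed.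

(** The rate of an exponential weight. Since [n b] is at most [L / 2], the Picard map contracts by
    1/2 in the sup norm weighted by [expR (- L t)], so convergence holds on the whole half-line at
    once; the [+ 1] keeps [L] positive. *)
Let L : R := 2 * (n%:R * b) + 1.
Let X : R := \sum_i `|x i 0|.

Lemma ac_expR (T : R) :
  ac 0 T (fun t => expR (L * t)) (fun t => L * expR (L * t)).
Proof.
have cE t : {for t, continuous (fun t : R => expR (L * t))}.
  apply: continuous_comp; last exact: continuous_expR.
  by apply: continuousM; [exact: cst_continuous|exact: cvg_id].
apply: ac_FTC => [t _|t _|t _] //.
  by apply: continuousM; [exact: cst_continuous|exact: cE].
have dl : is_derive t 1 (fun t : R => L * t) L.
  rewrite -[X in is_derive _ _ _ X]mulr1.
  exact: is_deriveZ.
rewrite mulrC.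
exact: (@is_derive1_comp R expR (fun t : R => L * t) t).
Qed.

Lemma picard_step k t i : 0 <= t ->
  `|picard k.+1 t i 0 - picard k t i 0| <= X * 2^-1 ^+ k * expR (L * t).
Proof.
have b0 : 0 <= b by apply: le_trans (Bb i i (lexx 0)).
have nb0 : 0 <= n%:R * b by rewrite mulr_ge0.
have X0 : 0 <= X by apply: sumr_ge0.
have L0 : 0 < L by rewrite /L; lra.
elim: k t i => [|k IH] t i t0.
  rewrite !mxE subr0 (_ : \int[leb]_(s in _) _ = 0); last first.
    rewrite (@eq_Rintegral _ _ _ _ _ (cst 0)) ?Rintegral_cst ?mul0r//.
    by move=> s _; rewrite mulmx0 mxE.
  rewrite addr0 expr0 mulr1 (@le_trans _ _ X)//.
    by rewrite /X (bigD1 i)//= lerDl sumr_ge0.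
  by rewrite ler_peMr// -expR0 ler_expR mulr_ge0// ltW.
rewrite [picard k.+2]lock [picard k.+1]lock -!lock /= !mxE.
rewrite opprD addrACA subrr add0r.
have ik := picard_integrable k t i.
have ik1 : leb.-integrable `[0, t] (EFin \o (fun t => (B t *m picard k.+1 t) i 0)).
  exact: picard_integrable.
rewrite -[X in X - _]/(\int[leb]_(s in `[0, t]) (B s *m picard k.+1 s) i 0).
rewrite -RintegralB//.
have iB : leb.-integrable `[0, t] (EFin \o (fun s =>
    (B s *m picard k.+1 s) i 0 - (B s *m picard k s) i 0)).
  exact: (integrableB _ ik1 ik).
have iE : leb.-integrable `[0, t] (EFin \o (fun s =>
    X * 2^-1 ^+ k.+1 * (L * expR (L * s)))).
  exact: (integrableZl _ _ (ac_expR t).1).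
apply: (le_trans (le_normr_Rintegral _ iB)) => //.
apply: (@le_trans _ _ (\int[leb]_(s in `[0, t])
    (X * 2^-1 ^+ k.+1 * (L * expR (L * s))))).
  apply: le_Rintegral => //; first exact: (integrable_norm iB).
  move=> s; rewrite /= in_itv /= => /andP[s0 st].
  have -> : (B s *m picard k.+1 s) i 0 - (B s *m picard k s) i 0 =
      (B s *m (picard k.+1 s - picard k s)) i 0.
    by rewrite mulmxBr [RHS]mxE [X in _ = _ + X]mxE.
  have := @mulmx_bound _ (picard k.+1 s - picard k s) s
    (X * 2^-1 ^+ k * expR (L * s)) i 0 s0.
  move=> /(_ _)/le_trans; apply.
    by move=> j; rewrite [X in `|X|]mxE [X in _ + X]mxE; apply: IH.
  rewrite exprSr; set e := expR _; set h := _ ^+ k.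
  have : 0 <= X * h * e by rewrite !mulr_ge0// ?expR_ge0// exprn_ge0.
  rewrite /L; nra.
rewrite RintegralZl//; last exact: (ac_expR t).1.
have := (ac_expR t).2 t; rewrite lexx t0 => /(_ isT) ->.
rewrite mulrDr lerDr mulr_ge0// ?expR_ge0// mulr_ge0// exprn_ge0//.
Qed.

(** Summing the increments of [picard_step] as a geometric series gives a bound uniform in [k],
    which serves as the dominating function for the limit. *)
Lemma picard_bound k t i : 0 <= t ->
  `|picard k t i 0| <= 2 * X * expR (L * t).
Proof.
move=> t0; have X0 : 0 <= X by apply: sumr_ge0.
have E0 := expR_ge0 (L * t).
suff: `|picard k t i 0| <= (2 - 2 * 2^-1 ^+ k) * (X * expR (L * t)).
  have : 0 <= 2^-1 ^+ k :> R by rewrite exprn_ge0.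
  have : 0 <= X * expR (L * t) by rewrite mulr_ge0.
  by nra.
elim: k => [|k IH]; first by rewrite mxE normr0 expr0 mulr1 subrr mul0r.
rewrite -[picard k.+1 t i 0](subrK (picard k t i 0)).
apply: (le_trans (ler_normD _ _)).
have := picard_step k i t0; move: IH; rewrite exprS; lra.
Qed.

Lemma picard_cvg t i : 0 <= t -> cvgn (fun k => picard k t i 0).
Proof.
move=> t0; pose u k := picard k.+1 t i 0 - picard k t i 0.
have -> : (fun k => picard k t i 0) = series u.
  apply/funext => k; rewrite /series /= telescope_sumr// !mxE subr0.
  by case: k => [|k]; rewrite ?mxE.
apply: normed_cvg; apply: series_le_cvg (fun=> normr_ge0 _) _ _ _; last first.
- apply: (@is_cvg_geometric_series _ (X * expR (L * t)) 2^-1).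
  by rewrite ger0_norm; lra.
- by move=> k; rewrite /geometric /= mulrAC; apply: picard_step.
- by move=> k; rewrite /geometric /= !mulr_ge0 ?expR_ge0 ?exprn_ge0// sumr_ge0.
Qed.

(** Pointwise limits of the Picard iterates stay measurable, and dominated convergence passes to the
    limit in the integral equation; bounded measurable coefficients are exactly what a glued linear
    feedback produces. *)
Theorem linear_ode_solution :
  exists2 xi : R -> 'cV[R]_n, xi 0 = x &
  forall T, mac 0 T xi (fun t => B t *m xi t).
Proof.
pose xi t : 'cV[R]_n := \col_i limn (fun k => picard k t i 0).
have xiP t i : 0 <= t -> (fun k => picard k t i 0) @ \oo --> xi t i 0.
  by move=> t0; rewrite mxE; exact: picard_cvg.
have xiE t i l : (fun k => picard k.+1 t i 0) @ \oo --> l -> xi t i 0 = l.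
  move=> cl; rewrite mxE; apply: cvg_lim => //.
  by rewrite -(cvg_shiftS (fun k => picard k t i 0)).
have xi0 : xi 0 = x.
  apply/matrixP => i j; rewrite (ord1 j); apply: xiE.
  apply: cvg_near_cst; apply: nearW => k.
  by rewrite mxE set_itv1 Rintegral_set1 addr0.
exists xi => // T i j; rewrite (ord1 j) {j}.
have mxi i' : measurable_fun (`[0, T] : set R) (fun t => xi t i' 0 : R).
  apply: (@measurable_fun_cvg _ _ R _ (fun k t => picard k t i' 0)).
    by move=> k; have [] := picard_measurable_bounded k T.
  by move=> t; rewrite /= in_itv /= => /andP[t0 _]; exact: xiP.
have key u : u <= T -> [/\ leb.-integrable `[0, u] (EFin \o (fun t => (B t *m xi t) i 0)) &
    (fun k => \int[leb]_(t in `[0, u]) (B t *m picard k t) i 0) @ \oo -->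
    \int[leb]_(t in `[0, u]) (B t *m xi t) i 0].
  move=> uT.
  have mxiu i' : measurable_fun (`[0, u] : set R) (fun t => xi t i' 0 : R).
    apply: measurable_funS (mxi i') => //.
    by apply: subset_itvl; rewrite bnd_simp.
  have [] := @dominated_convergence _ _ R leb `[0, u] _
    (fun k => EFin \o (fun t => (B t *m picard k t) i 0))
    (EFin \o (fun t => (B t *m xi t) i 0))
    (cst (n%:R * b * (2 * X * expR (L * T)))%:E).
  - by [].
  - by move=> k; apply: measurable_int (picard_integrable k u i).
  - by apply/measurable_EFinP; exact: measurable_mulmx.
  - apply: aeW => t; rewrite /= in_itv /= => /andP[t0 _].
    apply: cvg_EFin; first exact: nearW.
    rewrite mxE [X in X @ _ --> _](_ : _ =
      fun k => \sum_j B t i j * picard k t j 0); last first.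
      by apply/funext => k; rewrite /= mxE.
    apply: cvg_big => [|j _]; first exact: add_continuous.
    apply: cvgM; [exact: cvg_cst|exact: xiP].
  - apply: (bounded_integrable (m := `|n%:R * b * (2 * X * expR (L * T))|)) => //.
  - apply: aeW => t k; rewrite /= in_itv /= => /andP[t0 tu].
    rewrite lee_fin; apply: mulmx_bound => // j.
    apply: (le_trans (picard_bound k j t0)).
    have b0 : 0 <= b by apply: le_trans (Bb j j (lexx 0)).
    rewrite ler_wpM2l ?mulr_ge0 ?sumr_ge0// ler_expR ler_wpM2l ?(le_trans tu)//.
    have : 0 <= n%:R * b by rewrite mulr_ge0.
    by rewrite /L; lra.
  move=> iu _ cu; split=> //; apply: fine_cvg.
  by rewrite /Rintegral fineK//; exact: (integrable_fin_num _ iu).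
split; first by have [] := key T (lexx T).
move=> t /andP[t0 tT]; have [_ cu] := key t tT.
rewrite xi0; apply: xiE.
rewrite [X in X @ _ --> _](_ : _ = fun k =>
  x i 0 + \int[leb]_(s in `[0, t]) (B s *m picard k s) i 0).
  by apply: cvgD => //; exact: cvg_cst.
by apply/funext => k; rewrite mxE.
Qed.

End LinearODE.

(** * Quadratic forms *)

Section DotProduct.
Context {R : realType}.

Definition dot n (x y : 'cV[R]_n) : R := (x^T *m y) 0 0.

Lemma dotE n (x y : 'cV[R]_n) : dot x y = \sum_i x i 0 * y i 0.
Proof. by rewrite /dot mxE; apply: eq_bigr => i _; rewrite mxE. Qed.

Lemma dotC n (x y : 'cV[R]_n) : dot x y = dot y x.
Proof. by rewrite !dotE; apply: eq_bigr => i _; rewrite mulrC. Qed.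

Lemma dotDl n (x y z : 'cV[R]_n) : dot (x + y) z = dot x z + dot y z.
Proof. by rewrite /dot linearD mulmxDl mxE. Qed.

Lemma dotZl n a (x y : 'cV[R]_n) : dot (a *: x) y = a * dot x y.
Proof. by rewrite /dot linearZ -scalemxAl mxE. Qed.

Lemma dotDr n (x y z : 'cV[R]_n) : dot x (y + z) = dot x y + dot x z.
Proof. by rewrite dotC dotDl !(dotC _ x). Qed.

Lemma dotZr n a (x y : 'cV[R]_n) : dot x (a *: y) = a * dot x y.
Proof. by rewrite dotC dotZl dotC. Qed.

Lemma dotBl n (x y z : 'cV[R]_n) : dot (x - y) z = dot x z - dot y z.
Proof. by rewrite dotDl -scaleN1r dotZl mulN1r. Qed.

Lemma dotBr n (x y z : 'cV[R]_n) : dot x (y - z) = dot x y - dot x z.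
Proof. by rewrite dotC dotBl !(dotC _ x). Qed.

Lemma dotMl n p (A : 'M[R]_(n, p)) x y : dot (A *m x) y = dot x (A^T *m y).
Proof. by rewrite /dot trmx_mul mulmxA. Qed.

Lemma dot_ge0 n (x : 'cV[R]_n) : 0 <= dot x x.
Proof. by rewrite dotE sumr_ge0// => i _; rewrite -expr2 sqr_ge0. Qed.

Lemma enorm_sqr n (x : 'cV[R]_n) : enorm x ^+ 2 = dot x x.
Proof.
rewrite /enorm sqr_sqrtr ?dotE; first by apply: eq_bigr => i _; rewrite expr2.
by apply: sumr_ge0 => i _; rewrite sqr_ge0.
Qed.

Lemma qformE n (P : 'M[R]_n) x : qform P x = dot x (P *m x).
Proof. by rewrite /qform /dot mulmxA. Qed.

Lemma qformD n (P Q : 'M[R]_n) x : qform (P + Q) x = qform P x + qform Q x.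
Proof. by rewrite !qformE mulmxDl dotDr. Qed.

Lemma qformZ n a (P : 'M[R]_n) x : qform (a *: P) x = a * qform P x.
Proof. by rewrite !qformE -scalemxAl dotZr. Qed.

Lemma qformB n (P Q : 'M[R]_n) x : qform (P - Q) x = qform P x - qform Q x.
Proof. by rewrite !qformE mulmxBl dotBr. Qed.

Lemma qform_scalar n a (x : 'cV[R]_n) : qform a%:M x = a * enorm x ^+ 2.
Proof. by rewrite qformE mul_scalar_mx dotZr enorm_sqr. Qed.

Lemma qform_tr n (P : 'M[R]_n) x : qform P^T x = qform P x.
Proof. by rewrite !qformE -dotMl dotC. Qed.

Lemma qform_eq0 n (x : 'cV[R]_n) : qform 0 x = 0.
Proof. by rewrite /qform mulmx0 mul0mx mxE. Qed.

Lemma symmetricmxE n (P : 'M[R]_n) : (P \is symmetricmx) = (P^T == P).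
Proof.
by rewrite qualifE /= expr0 scale1r map_mx_id// eq_sym.
Qed.

Lemma symmetric_tr n (P : 'M[R]_n) : P \is symmetricmx -> P^T = P.
Proof. by rewrite symmetricmxE => /eqP. Qed.

Lemma symmetric_dot n (P : 'M[R]_n) x y : P \is symmetricmx ->
  dot x (P *m y) = dot (P *m x) y.
Proof. by move=> /symmetric_tr symP; rewrite dotMl symP. Qed.

Lemma symmetricD n (P Q : 'M[R]_n) : P \is symmetricmx -> Q \is symmetricmx ->
  P + Q \is symmetricmx.
Proof.
by rewrite !symmetricmxE => /eqP symP /eqP symQ; rewrite linearD /= symP symQ.
Qed.

Lemma symmetricZ n a (P : 'M[R]_n) : P \is symmetricmx -> a *: P \is symmetricmx.
Proof. by rewrite !symmetricmxE => /eqP symP; rewrite linearZ /= symP. Qed.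

Lemma symmetric_scalar n a : (a%:M : 'M[R]_n) \is symmetricmx.
Proof. by rewrite symmetricmxE tr_scalar_mx. Qed.

(* With d = lambda - P, the identity
   lambda (lambda^2 - P^2) = 2 P d P + 3 d P d + d d d
   exhibits the left-hand side as a sum of positive semidefinite matrices. *)
Lemma loewner_sqr n (P : 'M[R]_n) l x : P \is symmetricmx -> 0 < l ->
  loewner_le 0 P -> loewner_le P l%:M ->
  dot (P *m x) (P *m x) <= l ^+ 2 * dot x x.
Proof.
move=> symP l0 P0 Pl.
pose d := l *: x - P *m x.
have h1 := Pl (P *m x); have h2 := P0 d; have h3 := Pl d.
rewrite qform_scalar enorm_sqr qformE in h1.
rewrite qform_scalar enorm_sqr qformE in h3.
rewrite qform_eq0 qformE in h2.
suff : l * (l ^+ 2 * dot x x - dot (P *m x) (P *m x)) >= 0.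
  by rewrite pmulr_rge0// subr_ge0.
have -> : l * (l ^+ 2 * dot x x - dot (P *m x) (P *m x)) =
  2 * (l * dot (P *m x) (P *m x) - dot (P *m x) (P *m (P *m x))) +
  3 * dot d (P *m d) + (l * dot d d - dot d (P *m d)).
  rewrite /d !mulmxBr -!scalemxAr.
  rewrite !(dotBl, dotBr, dotZl, dotZr) !(symmetric_dot _ _ symP).
  ring.
lra.
Qed.

(* The adjoint has the same operator norm: with v = B^T x expand
   0 <= |c^2 x - B v|^2. *)
Lemma dot_tr_bound n k (B : 'M[R]_(n, k)) c x : 0 < c ->
  (forall v, dot (B *m v) (B *m v) <= c ^+ 2 * dot v v) ->
  dot (B^T *m x) (B^T *m x) <= c ^+ 2 * dot x x.
Proof.
move=> c0 Bc; pose v := B^T *m x.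
have := dot_ge0 (c ^+ 2 *: x - B *m v); have := Bc v.
rewrite !(dotBl, dotBr, dotZl, dotZr) (dotC x (B *m v)).
have -> : dot (B *m v) x = dot v v by rewrite dotMl.
rewrite -/v; set a := dot (B *m v) _; set q := dot v v; set r := dot x x.
move=> h1 h2.
have : 0 <= c ^+ 2 * (c ^+ 2 * r - q) by lra.
by rewrite pmulr_rge0 ?exprn_gt0// subr_ge0.
Qed.

Lemma enorm_ge0 n (x : 'cV[R]_n) : 0 <= enorm x.
Proof. exact: sqrtr_ge0. Qed.

Lemma enormZ n a (x : 'cV[R]_n) : enorm (a *: x) = `|a| * enorm x.
Proof.
rewrite -[LHS]ger0_norm ?enorm_ge0// -sqrtr_sqr enorm_sqr dotZl dotZr mulrA.
by rewrite -expr2 -enorm_sqr -exprMn sqrtr_sqr normrM (ger0_norm (enorm_ge0 _)).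
Qed.

Lemma enorm_eq0 n (x : 'cV[R]_n) : enorm x = 0 -> x = 0.
Proof.
move=> x0; have := enorm_sqr x; rewrite x0 expr0n /= dotE => /esym/eqP.
rewrite psumr_eq0; last by move=> i _; rewrite -expr2 sqr_ge0.
move=> /allP h; apply/matrixP => i j; rewrite (ord1 j) mxE.
by have := h i (mem_index_enum _); rewrite /= mulf_eq0 orbb => /eqP.
Qed.

Lemma coord_le_enorm n (x : 'cV[R]_n) i : `|x i 0| <= enorm x.
Proof.
rewrite -sqrtr_sqr ler_sqrt; last by apply: sumr_ge0 => j _; rewrite sqr_ge0.
by rewrite (bigD1 i)//= lerDl; apply: sumr_ge0 => j _; rewrite sqr_ge0.
Qed.

Lemma opnorm_bound n k (B : 'M[R]_(n, k)) c v : opnorm B <= c ->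
  dot (B *m v) (B *m v) <= c ^+ 2 * dot v v.
Proof.
move=> Bc; rewrite -!enorm_sqr -exprMn.
have [v0|v0] := eqVneq (enorm v) 0.
  rewrite (enorm_eq0 v0) mulmx0 enorm_sqr /dot mulmx0 mxE sqr_ge0//.
have vp : 0 < enorm v by rewrite lt_def v0 enorm_ge0.
suff : enorm (B *m ((enorm v)^-1 *: v)) <= c.
  rewrite -scalemxAr enormZ gtr0_norm ?invr_gt0// ler_pdivrMl// mulrC => h.
  have h0 := enorm_ge0 (B *m v).
  by rewrite ler_sqr// nnegrE (le_trans h0).
apply: le_trans Bc; apply: ub_le_sup; last first.
  by exists ((enorm v)^-1 *: v) => //=; rewrite enormZ gtr0_norm ?invr_gt0// mulVf.
(* The set whose [sup] is taken must be bounded: entries of a vector in the unit ball are at most 1,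
   so entry i of [B *m w] is at most the i-th absolute row sum. *)
exists (Num.sqrt (\sum_i (\sum_j `|B i j|) ^+ 2)) => _ [w /= w1 <-].
rewrite ler_sqrt; last by apply: sumr_ge0 => i _; rewrite sqr_ge0.
apply: ler_sum => i _; rewrite mxE -[leLHS]real_normK ?num_real//.
rewrite ler_sqr ?nnegrE ?sumr_ge0//.
apply: (le_trans (ler_norm_sum _ _ _)); apply: ler_sum => j _.
by rewrite normrM ler_piMr// (le_trans (coord_le_enorm _ _)).
Qed.

End DotProduct.

(** * Verification identity *)

(** Valid without measurability or integrability: the extended integral is nonpositive in any case,
    and [fine] sends infinite values to 0. *)
Lemma Rintegral_le0 d (T : measurableType d) (R : realType)
    (mu : {measure set T -> \bar R}) (E : set T) (f : T -> R) :
  (forall t, E t -> f t <= 0) -> \int[mu]_(t in E) f t <= 0.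
Proof.
move=> f0; apply: fine_le0.
have -> : (fun t => (f t)%:E) = (fun t => - (- f t)%:E)%E.
  by apply/funext => t; rewrite EFinN oppeK.
rewrite integral_ge0N ?oppe_le0 ?integral_ge0// => t Et.
  by rewrite lee_fin oppr_ge0 f0.
by rewrite lee_fin oppr_ge0 f0.
Qed.

Section HalfOpen.
Context {R : realType}.
Notation leb := (@lebesgue_measure R).
Implicit Types (a b c : R) (f : R -> R).

Lemma integrable_itv_co a b f : leb.-integrable `[a, b] (EFin \o f) ->
  leb.-integrable `[a, b[ (EFin \o f).
Proof.
by apply: integrableS => //; apply: subset_itv; rewrite bnd_simp.
Qed.

(** The right end is a null set; a glued control may already belong to the next piece there. *)
Lemma ge_Rintegral a b c f : a <= b -> leb.-integrable `[a, b] (EFin \o f) ->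
  (forall t, a <= t < b -> c <= f t) ->
  c * (b - a) <= \int[leb]_(t in `[a, b]) f t.
Proof.
move=> ab intf cf; have ico := integrable_itv_co intf.
rewrite -Rintegral_itv_bndo_bndc//.
have mE : fine (leb `[a, b[%classic) = b - a.
  rewrite lebesgue_measure_itv /= lte_fin; case: ifP => //= ba.
  by apply/esym/eqP; rewrite subr_eq0 eq_le ab leNgt ba.
rewrite -mE -Rintegral_cst//; apply: le_Rintegral => //.
  by apply: (integrable_itv_co (f := cst c)); apply: (bounded_integrable (m := `|c|)).
Qed.

End HalfOpen.

Section Verification.
Context {R : realType} {M n k : nat} (S : lq_data R M n k).
Notation leb := (@lebesgue_measure R).
Notation A := (lq_A S).
Notation sigma := (lq_sigma S).
Notation D := (lq_D S).
Notation gamma := (lq_gamma S).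
Notation Phi := (riccati_field S).

(** The maximizer in [w] of the Hamiltonian with costate [Y *m x]; [complete_square] shows its
    optimality. *)
Definition feedback (m : 'I_M) (Y : 'M[R]_n) (x : 'cV[R]_n) : 'cV[R]_k :=
  (gamma ^+ 2)^-1 *: ((sigma m)^T *m (Y *m x)).

Definition payoff_rate (m : 'I_M) (x : 'cV[R]_n) (w : 'cV[R]_k) : R :=
  2^-1 * qform (D m) x - gamma ^+ 2 / 2 * enorm w ^+ 2.

Lemma Sigma_dot m (x : 'cV[R]_n) : dot x (lq_Sigma S m *m x) =
  (gamma ^+ 2)^-1 * dot ((sigma m)^T *m x) ((sigma m)^T *m x).
Proof.
by rewrite /lq_Sigma -scalemxAl dotZr dotMl trmxK !mulmxA.
Qed.

Lemma qform_riccati_field m (Y : 'M[R]_n) x : Y \is symmetricmx ->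
  qform (Phi m Y) x = 2 * dot x ((A m)^T *m (Y *m x)) +
    (gamma ^+ 2)^-1 * dot ((sigma m)^T *m (Y *m x)) ((sigma m)^T *m (Y *m x)) +
    qform (D m) x.
Proof.
move=> symY; rewrite /riccati_field !qformD.
have -> : qform ((A m)^T *m Y) x = dot x ((A m)^T *m (Y *m x)).
  by rewrite qformE mulmxA.
have -> : qform (Y *m A m) x = dot x ((A m)^T *m (Y *m x)).
  by rewrite qformE -mulmxA (symmetric_dot _ _ symY) dotC dotMl.
rewrite [qform (Y *m _ *m Y) x]qformE -!mulmxA (symmetric_dot _ _ symY) Sigma_dot.
by ring.
Qed.

(** The left-hand side is the payoff rate plus the rate of change of half the quadratic form of [Y]
    along the dynamics; all dependence on [w] is collected in one negative square. *)
Lemma complete_square (m : 'I_M) (Y Y' : 'M[R]_n) x w : Y \is symmetricmx ->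
  let f := A m *m x + sigma m *m w in
  payoff_rate m x w +
    2^-1 * (qform Y' x + ((f^T *m Y *m x) 0 0 + (x^T *m Y *m f) 0 0)) =
  2^-1 * qform (Y' + Phi m Y) x
    - gamma ^+ 2 / 2 * enorm (w - feedback m Y x) ^+ 2.
Proof.
move=> symY f; rewrite /payoff_rate qformD qform_riccati_field// !enorm_sqr.
have -> : (f^T *m Y *m x) 0 0 = dot f (Y *m x) by rewrite /dot mulmxA.
have -> : (x^T *m Y *m f) 0 0 = dot f (Y *m x).
  by rewrite [RHS]dotC -(symmetric_dot _ _ symY) /dot mulmxA.
have -> : dot f (Y *m x) =
    dot x ((A m)^T *m (Y *m x)) + dot w ((sigma m)^T *m (Y *m x)).
  by rewrite /f dotDl !dotMl.
rewrite /feedback; move: ((sigma m)^T *m (Y *m x)) => v.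
rewrite !(dotBl, dotBr, dotZl, dotZr) (dotC v w).
have g0 : gamma != 0 by rewrite gt_eqF// lq_gamma_gt0.
field.
exact: g0.
Qed.

Section Trajectory.
Variables (x : 'cV[R]_n) (w : R -> 'cV[R]_k) (mu : R -> 'I_M) (xi : R -> 'cV[R]_n).
Hypotheses (wd : disturbance w) (mus : switching mu).
Hypothesis xit : trajectory S x w mu xi.

Notation l t := (payoff_rate (mu t) (xi t) (w t)).

Lemma trajectory0 : xi 0 = x.
Proof.
apply/matrixP => i j; rewrite (ord1 j).
by have [_ ->] := xit (lexx 0) i; rewrite set_itv1 Rintegral_set1 addr0.
Qed.

Lemma trajectory_mac a b : 0 <= a ->
  mac a b xi (fun t => A (mu t) *m xi t + sigma (mu t) *m w t).
Proof.
move=> a0; have [ab|ba] := leP a b; last first.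
  move=> i j; split=> [|t /andP[aT /(le_trans aT)]]; last by rewrite leNgt ba.
  by rewrite set_itv_ge ?bnd_simp -?ltNge//; exact: integrable_set0.
have b0 := le_trans a0 ab.
apply: (@macS _ _ _ 0 b) => //.
move=> i j; rewrite (ord1 j); split; first exact: (xit b0 i).1.
move=> t /andP[t0 _]; rewrite (xit t0 i).2 trajectory0; congr (_ + _).
Qed.

(** A switching is known through its measurable level sets, so the function is expanded as a finite
    sum over the modes, each term multiplied by the indicator of a level set. *)
Lemma measurable_switch (E : set R) (g : 'I_M -> R -> R) :
  E `<=` `[0, +oo[ -> (forall m, measurable_fun E (g m)) ->
  measurable_fun E (fun t => g (mu t) t).
Proof.
move=> E0 mg.
pose F m : set R := `[0, +oo[ `&` mu @^-1` [set m].
apply: (@eq_measurable_fun _ _ _ _ _ (fun t => \sum_m \1_(F m) t * g m t)).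
  move=> t; rewrite inE => /E0 t0.
  have Et m : t \in F m = (mu t == m).
    by apply/idP/eqP => [|tm]; rewrite inE; [case|split].
  rewrite (bigD1 (mu t))//= indicE Et eqxx mul1r big1 ?addr0// => m mt.
  by rewrite indicE Et eq_sym (negbTE mt) mul0r.
apply: measurable_sum => m; apply: measurable_funM => //.
exact: (@measurable_indic _ _ _ _ _ (mus m)).
Qed.

Lemma measurable_traj (a b : R) i : 0 <= a ->
  measurable_fun (`[a, b] : set R) (fun t => xi t i 0 : R).
Proof. by move=> a0; exact: ac_measurable (trajectory_mac b a0 i 0). Qed.

Lemma integrable_enorm_sqr (a b : R) : 0 <= a ->
  leb.-integrable `[a, b] (EFin \o (fun t => enorm (w t) ^+ 2)).
Proof.
move=> a0; apply: (@integrable_itvS R 0 b) => //.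
have [mw wb] := wd.
apply/integrableP; split.
  apply/measurable_EFinP.
  rewrite (_ : (fun t => _) = fun t => \sum_i w t i 0 * w t i 0); last first.
    by apply/funext => t; rewrite enorm_sqr dotE.
  apply: measurable_sum => i; apply: measurable_funM.
    by apply: measurable_funS (mw i) => //; apply: subset_itvl; rewrite bnd_simp.
  by apply: measurable_funS (mw i) => //; apply: subset_itvl; rewrite bnd_simp.
under eq_integral do rewrite /= ger0_norm ?sqr_ge0//.
exact: wb.
Qed.

Lemma integrable_payoff (a b : R) : 0 <= a ->
  leb.-integrable `[a, b] (EFin \o (fun t => l t)).
Proof.
move=> a0.
have iw : leb.-integrable `[a, b]
    (EFin \o (fun t => gamma ^+ 2 / 2 * enorm (w t) ^+ 2)).
  exact: (integrableZl _ _ (integrable_enorm_sqr b a0)).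
suff iq : leb.-integrable `[a, b]
    (EFin \o (fun t => 2^-1 * qform (D (mu t)) (xi t))).
  exact: (integrableB _ iq iw).
have /choice[f fP] : forall i, exists m,
    forall t, a <= t <= b -> `|xi t i 0| <= m.
  by move=> i; have [m _ mP] := ac_bounded (trajectory_mac b a0 i 0); exists m.
apply: (@bounded_integrable R a b (\sum_m \sum_i (`|f i| * \sum_j `|D m i j| * `|f j|))).
  apply: (@measurable_switch `[a, b] (fun m t => 2^-1 * qform (D m) (xi t))) => [|m].
    by apply: subset_itv; rewrite bnd_simp.
  rewrite (_ : (fun t => _) = fun t =>
      2^-1 * \sum_i xi t i 0 * \sum_j D m i j * xi t j 0); last first.
    apply/funext => t; rewrite qformE dotE; congr (_ * _).
    by apply: eq_bigr => i _; rewrite mxE.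
  apply: measurable_funM => //; apply: measurable_sum => i.
  apply: measurable_funM; first exact: measurable_traj.
  apply: measurable_sum => j; apply: measurable_funM => //; exact: measurable_traj.
move=> t tab; have fb i : `|xi t i 0| <= `|f i|.
  by rewrite (le_trans (fP i t tab))// ler_norm.
rewrite (bigD1 (mu t))//= (@le_trans _ _ (`|qform (D (mu t)) (xi t)|))//.
  by rewrite normrM ger0_norm ?invr_ge0// ler_piMl// invf_le1// ler1n.
apply: le_trans (_ : \sum_i (`|f i| * \sum_j `|D (mu t) i j| * `|f j|) <= _); last first.
  rewrite lerDl; apply: sumr_ge0 => m _; apply: sumr_ge0 => i _.
  by rewrite mulr_ge0// sumr_ge0// => j _; rewrite mulr_ge0.
rewrite qformE dotE (le_trans (ler_norm_sum _ _ _))//; apply: ler_sum => i _.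
rewrite normrM ler_pM// mxE (le_trans (ler_norm_sum _ _ _))//.
by apply: ler_sum => j _; rewrite normrM ler_pM.
Qed.

Lemma running_payoffE T : 0 <= T ->
  running_payoff S w mu xi T = (\int[leb]_(t in `[0, T]) l t)%:E.
Proof.
move=> T0; rewrite /running_payoff /Rintegral fineK//.
exact: (integrable_fin_num _ (integrable_payoff T (lexx 0))).
Qed.

Section OnInterval.
Variables (a b : R) (Y Y' : R -> 'M[R]_n).
Hypotheses (a0 : 0 <= a) (ab : a <= b) (macY : mac a b Y Y').
Hypothesis symY : forall t, a <= t <= b -> Y t \is symmetricmx.

Lemma verification_identity :
  \int[leb]_(t in `[a, b]) l t
    + 2^-1 * qform (Y b) (xi b) - 2^-1 * qform (Y a) (xi a) =
  \int[leb]_(t in `[a, b]) (2^-1 * qform (Y' t + Phi (mu t) (Y t)) (xi t)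
    - gamma ^+ 2 / 2 * enorm (w t - feedback (mu t) (Y t) (xi t)) ^+ 2).
Proof.
have acq := acZ 2^-1 (mac_qform macY (trajectory_mac b a0)).
rewrite -addrA (ac_diff acq (lexx a) ab (lexx b)).
rewrite -RintegralD//; [|exact: integrable_payoff|exact: acq.1].
apply: eq_Rintegral => t; rewrite inE /= in_itv /= => tab.
by rewrite complete_square// symY.
Qed.

Lemma verification_le :
  (forall t, a <= t <= b -> qform (Y' t + Phi (mu t) (Y t)) (xi t) <= 0) ->
  \int[leb]_(t in `[a, b]) l t + 2^-1 * qform (Y b) (xi b)
    <= 2^-1 * qform (Y a) (xi a).
Proof.
move=> Y0; rewrite -subr_le0 verification_identity.
apply: Rintegral_le0 => t; rewrite /= in_itv /= => tab.
have h1 := Y0 t tab.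
have h2 : 0 <= gamma ^+ 2 / 2 * enorm (w t - feedback (mu t) (Y t) (xi t)) ^+ 2.
  by rewrite mulr_ge0 ?divr_ge0 ?sqr_ge0.
lra.
Qed.

(* The hypotheses omit b because feedbacks are glued along half-open
   intervals. *)
Lemma verification_eq :
  (forall t, a <= t < b -> Y' t + Phi (mu t) (Y t) = 0) ->
  (forall t, a <= t < b -> w t = feedback (mu t) (Y t) (xi t)) ->
  \int[leb]_(t in `[a, b]) l t + 2^-1 * qform (Y b) (xi b)
    = 2^-1 * qform (Y a) (xi a).
Proof.
move=> Y0 wE; apply/eqP; rewrite -subr_eq0 verification_identity.
have acq := acZ 2^-1 (mac_qform macY (trajectory_mac b a0)).
rewrite -Rintegral_itv_bndo_bndc; last first.
  apply: integrable_itv_co.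
  apply: eq_integrable (integrableD _ (integrable_payoff b a0) acq.1) => //.
  move=> t; rewrite inE /= in_itv /= => tab.
  by rewrite -EFinD complete_square// symY.
rewrite (@eq_Rintegral _ _ _ _ _ (cst 0)) ?Rintegral_cst ?mul0r//.
move=> t; rewrite inE /= in_itv /= => tab.
by rewrite Y0// wE// subrr qform_eq0 enorm_sqr /dot mulmx0 mxE !mulr0 subrr.
Qed.

End OnInterval.
End Trajectory.
End Verification.

(** * Bounded measurable matrix functions and closed-loop trajectories *)

Section MatrixFunctions.
Context {R : realType}.

Definition mmeas p q (E : set R) (X : R -> 'M[R]_(p, q)) : Prop :=
  forall i j, measurable_fun E (fun t => X t i j : R).

Definition mbounded p q (E : set R) (X : R -> 'M[R]_(p, q)) : Prop :=
  exists c, forall t, E t -> forall i j, `|X t i j| <= c.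

Lemma mmeas_cst p q (E : set R) (X : 'M[R]_(p, q)) : mmeas E (fun=> X).
Proof. by move=> i j; exact: measurable_cst. Qed.

Lemma mmeasD p q (E : set R) (X Y : R -> 'M[R]_(p, q)) :
  mmeas E X -> mmeas E Y -> mmeas E (fun t => X t + Y t).
Proof.
move=> mX mY i j; under eq_fun do rewrite mxE.
exact: measurable_funD.
Qed.

Lemma mmeasM p q r (E : set R) (X : R -> 'M[R]_(p, q)) (Y : R -> 'M[R]_(q, r)) :
  mmeas E X -> mmeas E Y -> mmeas E (fun t => X t *m Y t).
Proof.
move=> mX mY i j; under eq_fun do rewrite mxE.
by apply: measurable_sum => k; exact: measurable_funM.
Qed.

Lemma mmeasZ p q (E : set R) c (X : R -> 'M[R]_(p, q)) :
  mmeas E X -> mmeas E (fun t => c *: X t).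
Proof.
by move=> mX i j; under eq_fun do rewrite mxE; exact: measurable_funM.
Qed.

Lemma finite_mx_bound p q (E : set R) (X : R -> 'M[R]_(p, q)) :
  (forall i j, exists c, forall t, E t -> `|X t i j| <= c) -> mbounded E X.
Proof.
move=> bX; have /choice[f fP] : forall ij : 'I_p * 'I_q,
    exists c, forall t, E t -> `|X t ij.1 ij.2| <= c by move=> [i j]; exact: bX.
exists (\sum_ij `|f ij|) => t Et i j.
rewrite (le_trans (fP (i, j) t Et))// (bigD1 (i, j))//=.
by rewrite (le_trans (ler_norm _))// lerDl sumr_ge0.
Qed.

Lemma mboundedD p q (E : set R) (X Y : R -> 'M[R]_(p, q)) :
  mbounded E X -> mbounded E Y -> mbounded E (fun t => X t + Y t).
Proof.
move=> [c Xc] [d Yd]; exists (c + d) => t Et i j.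
by rewrite mxE (le_trans (ler_normD _ _))// lerD ?Xc ?Yd.
Qed.

Lemma mboundedM p q r (E : set R) (X : R -> 'M[R]_(p, q)) (Y : R -> 'M[R]_(q, r)) :
  mbounded E X -> mbounded E Y -> mbounded E (fun t => X t *m Y t).
Proof.
move=> [c Xc] [d Yd]; exists (\sum_(k < q) c * d) => t Et i j.
rewrite mxE (le_trans (ler_norm_sum _ _ _))//; apply: ler_sum => k _.
by rewrite normrM ler_pM ?Xc ?Yd.
Qed.

Lemma mboundedZ p q (E : set R) c (X : R -> 'M[R]_(p, q)) :
  mbounded E X -> mbounded E (fun t => c *: X t).
Proof.
move=> [d Xd]; exists (`|c| * d) => t Et i j.
by rewrite mxE normrM ler_wpM2l ?Xd.
Qed.

Lemma mbounded_switch p q M (E : set R) (mu : R -> 'I_M) (X : 'I_M -> 'M[R]_(p, q)) :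
  mbounded E (fun t => X (mu t)).
Proof.
apply: finite_mx_bound => i j; exists (\sum_m `|X m i j|) => t _.
by rewrite (bigD1 (mu t))//= lerDl sumr_ge0.
Qed.

Lemma mmeas_switch p q M (E : set R) (mu : R -> 'I_M) (X : 'I_M -> 'M[R]_(p, q)) :
  switching mu -> E `<=` `[0, +oo[ -> mmeas E (fun t => X (mu t)).
Proof.
move=> mus E0 i j; apply: (measurable_switch mus (g := fun m _ => X m i j)) => //.
Qed.

Lemma mac_mmeas p q (X X' : R -> 'M[R]_(p, q)) a b : mac a b X X' ->
  mmeas `[a, b] X.
Proof. by move=> macX i j; exact: ac_measurable (macX i j). Qed.

Lemma mac_mbounded p q (X X' : R -> 'M[R]_(p, q)) a b : mac a b X X' ->
  mbounded `[a, b] X.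
Proof.
move=> macX; apply: finite_mx_bound => i j.
have [c _ cP] := ac_bounded (macX i j); exists c => t.
by rewrite /= in_itv /=; exact: cP.
Qed.

Lemma mac_mmeas_ge0 p q (X X' : R -> 'M[R]_(p, q)) :
  (forall T, mac 0 T X X') -> mmeas `[0, +oo[ X.
Proof.
move=> macX i j.
have -> : `[0, +oo[%classic = \bigcup_N `[0, N%:R]%classic :> set R.
  apply/seteqP; split=> t /=.
    rewrite in_itv /= andbT => t0; exists (Num.bound t) => //=.
    by rewrite in_itv /= t0 /= ltW// archi_boundP.
  by move=> [N _] /=; rewrite !in_itv /= andbT => /andP[].
apply/measurable_fun_bigcup => // N; exact: mac_mmeas (macX N%:R) i j.
Qed.

End MatrixFunctions.

Section ClosedLoop.
Context {R : realType} {M n k : nat} (S : lq_data R M n k).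
Notation leb := (@lebesgue_measure R).

(** Inserting the feedback makes the equation linear with bounded measurable matrix [B], hence
    globally solvable. The resulting [w] is bounded on bounded intervals, which makes it a
    disturbance. *)
Lemma closed_loop_trajectory (mu : R -> 'I_M) (K : R -> 'M[R]_n) (x : 'cV[R]_n) :
  switching mu -> mmeas `[0, +oo[ K -> mbounded `[0, +oo[ K ->
  exists xi : R -> 'cV[R]_n,
    let w t := feedback S (mu t) (K t) (xi t) in
    disturbance w /\ trajectory S x w mu xi.
Proof.
move=> mus mK bK.
pose g : R := (lq_gamma S ^+ 2)^-1.
pose B t := lq_A S (mu t) + g *: (lq_sigma S (mu t) *m
  ((lq_sigma S (mu t))^T *m K t)).
have mB : mmeas `[0, +oo[ B.
  apply: mmeasD; first exact: mmeas_switch.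
  apply: mmeasZ; apply: mmeasM; first exact: mmeas_switch.
  by apply: mmeasM => //; exact: (@mmeas_switch _ _ _ _ _ _ (fun m => (lq_sigma S m)^T)).
have [b bB] : mbounded `[0, +oo[ B.
  apply: mboundedD; first exact: mbounded_switch.
  apply: mboundedZ; apply: mboundedM; first exact: mbounded_switch.
  by apply: mboundedM => //; exact: (@mbounded_switch _ _ _ _ _ _ (fun m => (lq_sigma S m)^T)).
have bB' t i j : 0 <= t -> `|B t i j| <= b.
  by move=> t0; apply: bB; rewrite /= in_itv /= t0.
have [xi xi0 macxi] := linear_ode_solution x mB bB'.
exists xi => w; have fE t : lq_A S (mu t) *m xi t + lq_sigma S (mu t) *m w t =
    B t *m xi t.
  by rewrite /w /feedback mulmxDl -scalemxAl -scalemxAr !mulmxA.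
have mw : mmeas `[0, +oo[ w.
  apply: mmeasZ; apply: mmeasM.
    exact: (@mmeas_switch _ _ _ _ _ _ (fun m => (lq_sigma S m)^T)).
  by apply: mmeasM => //; exact: mac_mmeas_ge0 macxi.
split; last first.
  move=> T T0 i; split.
    by apply: eq_integrable (macxi T i 0).1 => // t _; rewrite /= fE.
  rewrite (macxi T i 0).2 ?T0 ?lexx// xi0; congr (_ + _).
  by apply: eq_Rintegral => t _; rewrite fE.
split; first by move=> i; exact: mw.
move=> T.
have sub0 : `[0, T]%classic `<=` (`[0, +oo[%classic : set R).
  by apply: subset_itvl; rewrite bnd_simp.
have [c wc] : mbounded `[0, T] w.
  apply: mboundedZ; apply: mboundedM.
    exact: (@mbounded_switch _ _ _ _ _ _ (fun m => (lq_sigma S m)^T)).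
  apply: mboundedM; last exact: mac_mbounded (macxi T).
  by have [d Kd] := bK; exists d => t /sub0; exact: Kd.
have iw : leb.-integrable `[0, T] (EFin \o (fun t => enorm (w t) ^+ 2)).
  apply: (@bounded_integrable R 0 T (\sum_(i < k) c * c)).
    have -> : (fun t => enorm (w t) ^+ 2) = fun t => \sum_i w t i 0 * w t i 0.
      by apply/funext => t; rewrite enorm_sqr dotE.
    apply: measurable_sum => i.
    by apply: measurable_funM; apply: measurable_funS (mw i 0).
  move=> t tT; rewrite enorm_sqr dotE (le_trans (ler_norm_sum _ _ _))//.
  apply: ler_sum => i _; have wi := wc t tT i 0.
  by rewrite normrM ler_pM.
have /integrableP[_] := iw.
by under eq_integral do rewrite /= ger0_norm ?sqr_ge0//.
Qed.

End ClosedLoop.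

(** * Riccati solutions and the semigroup of one mode *)

Section ContinuousMatrices.
Context {R : realType}.

Definition mcont p q (X : R -> 'M[R]_(p, q)) (t : R) : Prop :=
  forall i j, {for t, continuous (fun s => X s i j)}.

Lemma mcont_cst p q (X : 'M[R]_(p, q)) t : mcont (fun=> X) t.
Proof. by move=> i j; exact: cst_continuous. Qed.

Lemma mcontD p q (X Y : R -> 'M[R]_(p, q)) t :
  mcont X t -> mcont Y t -> mcont (fun s => X s + Y s) t.
Proof.
move=> cX cY i j.
have -> : (fun s => (X s + Y s) i j) = fun s => X s i j + Y s i j.
  by apply/funext => s; rewrite mxE.
by apply: continuousD; [exact: cX|exact: cY].
Qed.

Lemma mcontM p q r (X : R -> 'M[R]_(p, q)) (Y : R -> 'M[R]_(q, r)) t :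
  mcont X t -> mcont Y t -> mcont (fun s => X s *m Y s) t.
Proof.
move=> cX cY i j.
have -> : (fun s => (X s *m Y s) i j) = fun s => \sum_l X s i l * Y s l j.
  by apply/funext => s; rewrite mxE.
apply: cvg_big => [|l _]; first exact: add_continuous.
by apply: continuousM; [exact: cX|exact: cY].
Qed.

Lemma mcontN p q (X : R -> 'M[R]_(p, q)) t : mcont X t -> mcont (fun s => - X s) t.
Proof.
move=> cX i j.
have -> : (fun s => (- X s) i j) = fun s => - X s i j.
  by apply/funext => s; rewrite mxE.
by apply: continuousN; exact: cX.
Qed.

Lemma mcont_comp_rev p q (X : R -> 'M[R]_(p, q)) b t :
  mcont X (b - t) -> mcont (fun s => X (b - s)) t.
Proof.
move=> cX i j; apply: (@continuous_comp _ _ _ (fun s => b - s) (fun u => X u i j)).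
  by apply: continuousB; [exact: cst_continuous|exact: cvg_id].
exact: cX.
Qed.

End ContinuousMatrices.

Section RiccatiSolutions.
Context {R : realType} {M n k : nat} (S : lq_data R M n k).
Notation leb := (@lebesgue_measure R).
Notation Phi := (riccati_field S).
Variables (m : 'I_M) (P0 : 'M[R]_n) (T : \bar R) (P : R -> 'M[R]_n).
Hypothesis solP : riccati_solution S m P0 T P.

Lemma riccati_init : P 0 = P0.
Proof. by case: solP. Qed.

Lemma riccati_sym t : 0 <= t -> (t%:E < T)%E -> P t \is symmetricmx.
Proof. by case: solP => _ _ + _ _; apply. Qed.

Lemma mcont_Phi (X : R -> 'M[R]_n) t : mcont X t -> mcont (fun s => Phi m (X s)) t.
Proof.
move=> cX; apply: mcontD; last exact: mcont_cst.
apply: mcontD.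
  by apply: mcontD; apply: mcontM => //; exact: mcont_cst.
by apply: mcontM => //; apply: mcontM => //; exact: mcont_cst.
Qed.

(* Extending P by P 0 on the negative reals turns the one-sided continuity
   at 0 into a two-sided one. *)
Lemma riccati_ext_cont t : (t%:E < T)%E -> mcont (fun s => P (Num.max 0 s)) t.
Proof.
move=> tT i j; have [_ _ _ cP dP] := solP.
have [t0|t0|t0] := ltgtP t 0; last first.
- rewrite t0; apply/left_right_continuousP; rewrite maxxx; split.
    have h : (fun=> P 0 i j) @ (0 : R)^'- --> P 0 i j by exact: cvg_cst.
    apply: cvg_trans h; apply: near_eq_cvg; near=> s; rewrite /= max_l//.
  apply: cvg_trans (cP i j); apply: near_eq_cvg; near=> s; rewrite /= max_r//.
- have h : (fun s => P s i j) @ t --> P (Num.max 0 t) i j.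
    rewrite max_r ?ltW//; apply: differentiable_continuous.
    by apply/derivable1_diffP; have [] := dP t t0 tT i j.
  apply: cvg_trans h; apply: near_eq_cvg; near=> s; rewrite /= max_r//.
  by apply: ltW; near: s; exact: lt_nbhsr.
- have h : (fun=> P 0 i j) @ t --> P (Num.max 0 t) i j.
    by rewrite max_l ?ltW//; exact: cvg_cst.
  apply: cvg_trans h; apply: near_eq_cvg; near=> s; rewrite /= max_l//.
  by apply: ltW; near: s; exact: lt_nbhsl.
Unshelve. all: by end_near. Qed.

(** The time-reversed solution satisfies Y' + Phi(Y) = 0, runs from [P s] at time [a] to the initial
    matrix at time [a + s], and so is the path for the equality case of the verification. *)
Lemma riccati_reverse_mac a s : 0 <= s -> (s%:E < T)%E ->
  mac a (a + s) (fun t => P (a + s - t)) (fun t => - Phi m (P (a + s - t))).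
Proof.
move=> s0 sT.
pose Q u := P (Num.max 0 u).
have QE t : t <= a + s -> Q (a + s - t) = P (a + s - t).
  by move=> tb; rewrite /Q max_r// subr_ge0.
have ltT t : a <= t -> ((a + s - t)%:E < T)%E.
  move=> aT; apply: le_lt_trans sT; rewrite lee_fin; lra.
move=> i j.
apply: (@eq_ac _ _ _ (fun t => Q (a + s - t) i j) _
    (fun t => (- Phi m (Q (a + s - t))) i j)) => [t|t|].
- by move=> /andP[_ tb]; rewrite QE.
- by move=> /andP[_ tb]; rewrite QE.
have cQ t : a <= t -> mcont (fun t => Q (a + s - t)) t.
  move=> aT; apply: mcont_comp_rev.
  by apply: riccati_ext_cont; exact: ltT.
apply: ac_FTC => [t /andP[aT _]|t /andP[aT _]|t /andP[aT tb]].
- exact: cQ.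
- by apply: mcontN; apply: mcont_Phi; exact: cQ.
have u0 : 0 < a + s - t by rewrite subr_gt0.
have [_ _ _ _ dP] := solP.
have dQ : is_derive (a + s - t) 1 (fun u => Q u i j) (Phi m (P (a + s - t)) i j).
  apply: near_eq_is_derive (dP _ u0 (ltT t (ltW aT)) i j).
  near=> u; rewrite /Q max_r//.
  by apply: ltW; near: u; exact: lt_nbhsr.
have dl : is_derive t 1 (fun u : R => a + s - u) (-1).
  rewrite -[X in is_derive _ _ _ X]add0r.
  exact: is_deriveB.
rewrite QE ?ltW// mxE -mulrN1.
exact: (@is_derive1_comp R (fun u => Q u i j) (fun u : R => a + s - u) t).
Unshelve. all: by end_near. Qed.

Lemma riccati_within_continuous s i j : (s%:E < T)%E ->
  {within `[0, s], continuous (fun t => P t i j)}.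
Proof.
move=> sT.
have h : {within `[0, s], continuous (fun t => P (Num.max 0 t) i j)}.
  apply: continuous_in_subspaceT => t; rewrite inE /= in_itv /= => /andP[_ ts].
  by apply: riccati_ext_cont; apply: le_lt_trans sT; rewrite lee_fin.
apply: (subspace_eq_continuous _ h) => t; rewrite inE /= in_itv /= => /andP[t0 _].
by rewrite /from_subspace max_r.
Qed.

(** The intermediate time depends on the entry [i j]. This is harmless, as only entrywise estimates
    are drawn from it. *)
Lemma riccati_mean_value s i j : 0 < s -> (s%:E < T)%E ->
  exists2 c, 0 < c < s & P s i j - P0 i j = s * Phi m (P c) i j.
Proof.
move=> s0 sT; have [_ _ _ _ dP] := solP.
have [||c] := @MVT R (fun t => P t i j) (fun t => Phi m (P t) i j) 0 s s0.
- move=> t; rewrite in_itv /= => /andP[t0 ts]; apply: dP => //.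
  by apply: lt_trans sT; rewrite lte_fin.
- exact: riccati_within_continuous.
rewrite in_itv /= subr0 riccati_init mulrC => cs cE.
by exists c.
Qed.

End RiccatiSolutions.

Lemma switching_cst {R : realType} {M : nat} (m : 'I_M) :
  @switching R M (fun=> m).
Proof.
by move=> m'; rewrite preimage_cst; case: ifP => _; rewrite ?setIT ?setI0.
Qed.

Section RiccatiSemigroup.
Context {R : realType} {M n k : nat} (S : lq_data R M n k).
Notation leb := (@lebesgue_measure R).
Notation Phi := (riccati_field S).
Variables (m : 'I_M) (P0 : 'M[R]_n) (T : \bar R) (P : R -> 'M[R]_n).
Hypothesis solP : riccati_solution S m P0 T P.

Lemma riccati_reverse_sym a s t : (s%:E < T)%E -> a <= t <= a + s ->
  P (a + s - t) \is symmetricmx.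
Proof.
move=> sT /andP[aT tb]; apply: (riccati_sym solP); first by rewrite subr_ge0.
by apply: le_lt_trans sT; rewrite lee_fin; lra.
Qed.

(** The starting time [u] is free inside the step because [closed_loop_decay] reads off the
    remaining payoff at every intermediate time. Agreement with the mode and the feedback is asked
    only on the half-open interval, as gluing provides. *)
Lemma closed_loop_payoff (x : 'cV[R]_n) w mu xi a s u :
  disturbance w -> switching mu -> trajectory S x w mu xi ->
  0 <= a -> 0 <= s -> (s%:E < T)%E -> a <= u <= a + s ->
  (forall t, u <= t < a + s -> mu t = m) ->
  (forall t, u <= t < a + s -> w t = feedback S m (P (a + s - t)) (xi t)) ->
  \int[leb]_(t in `[u, a + s]) payoff_rate S (mu t) (xi t) (w t)
    + 2^-1 * qform P0 (xi (a + s)) = 2^-1 * qform (P (a + s - u)) (xi u).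
Proof.
move=> wd mus xit a0 s0 sT /andP[au us] muE wE.
have macP := macS (riccati_reverse_mac solP a s0 sT) au (lexx _).
have u0 := le_trans a0 au.
have symP t : u <= t <= a + s -> P (a + s - t) \is symmetricmx.
  move=> /andP[ut tb]; apply: riccati_reverse_sym => //.
  by rewrite tb (le_trans au).
rewrite -(verification_eq wd mus xit u0 us macP symP).
- by rewrite subrr (riccati_init solP).
- by move=> t tu; rewrite muE// addNr.
- by move=> t tu; rewrite muE// wE.
Qed.

Lemma riccati_payoff_le (x : 'cV[R]_n) w xi s :
  disturbance w -> trajectory S x w (fun=> m) xi ->
  0 <= s -> (s%:E < T)%E ->
  \int[leb]_(t in `[0, s]) payoff_rate S m (xi t) (w t)
    + 2^-1 * qform P0 (xi s) <= 2^-1 * qform (P s) x.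
Proof.
move=> wd xit s0 sT.
have mus := @switching_cst R M m.
have macP := riccati_reverse_mac solP 0 s0 sT.
have symP t : 0 <= t <= 0 + s -> P (0 + s - t) \is symmetricmx.
  exact: riccati_reverse_sym.
have := verification_le wd mus xit (lexx 0) _ macP symP.
rewrite add0r => /(_ s0); rewrite subrr subr0 (trajectory0 xit) (riccati_init solP).
by apply => t _; rewrite addNr qform_eq0.
Qed.

(** Cutting off by an indicator gives a gain that is bounded and measurable on the whole half-line,
    although [P] is controlled only on its interval of existence. *)
Definition riccati_gain (a s t : R) : 'M[R]_n :=
  (\1_(`[a, a + s]%classic : set R) t : R) *: P (a + s - t).

Lemma riccati_gainE a s t : a <= t <= a + s -> riccati_gain a s t = P (a + s - t).
Proof. by move=> ts; rewrite /riccati_gain indicE mem_set ?scale1r//= in_itv. Qed.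

Lemma riccati_gain_mmeas a s : 0 <= a -> 0 <= s -> (s%:E < T)%E ->
  mmeas `[0, +oo[ (riccati_gain a s).
Proof.
move=> a0 s0 sT i j.
rewrite (_ : (fun t => _) = (fun t => P (a + s - t) i j) \_ `[a, a + s]).
  apply/measurable_restrict => //.
  rewrite setIidr; first exact: mac_mmeas (riccati_reverse_mac solP a s0 sT) i j.
  by apply: subset_itv; rewrite bnd_simp.
apply/funext => t; rewrite mxE patchE indicE.
by case: ifP => _; rewrite ?mul1r ?mul0r.
Qed.

Lemma riccati_gain_mbounded a s : 0 <= s -> (s%:E < T)%E ->
  mbounded `[0, +oo[ (riccati_gain a s).
Proof.
move=> s0 sT.
have [c Pc] := mac_mbounded (riccati_reverse_mac solP a s0 sT).
exists `|c| => t _ i j.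
rewrite mxE indicE; case: (boolP (t \in _)) => [|_]; last by rewrite mul0r normr0.
by rewrite inE mul1r => /Pc/(_ i j)/le_trans; apply; exact: ler_norm.
Qed.

Lemma riccati_payoff_attained (x : 'cV[R]_n) s : 0 <= s -> (s%:E < T)%E ->
  exists w xi, [/\ disturbance w, trajectory S x w (fun=> m) xi &
  \int[leb]_(t in `[0, s]) payoff_rate S m (xi t) (w t)
    + 2^-1 * qform P0 (xi s) = 2^-1 * qform (P s) x].
Proof.
move=> s0 sT.
have mus := @switching_cst R M m.
have mK := riccati_gain_mmeas (lexx 0) s0 sT.
have bK := riccati_gain_mbounded 0 s0 sT.
have [xi [wd xit]] := closed_loop_trajectory S x mus mK bK.
eexists; exists xi; split; [exact: wd|exact: xit|].
have := closed_loop_payoff wd mus xit (lexx 0) s0 sT (u := 0).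
rewrite add0r lexx s0 subr0 (trajectory0 xit) => -> // t /andP[t0 ts].
by rewrite riccati_gainE add0r// t0 ltW.
Qed.

Lemma semigroup_quad (x : 'cV[R]_n) s : 0 <= s -> (s%:E < T)%E ->
  semigroup S m s (quad P0) x = quad (P s) x.
Proof.
move=> s0 sT.
have mus := @switching_cst R M m.
apply/eqP; rewrite eq_le; apply/andP; split.
  apply: ge_ereal_sup => _ [w [xi [wd xit ->]]].
  rewrite (running_payoffE wd mus xit s0) /quad -EFinD lee_fin.
  exact: riccati_payoff_le.
have [w [xi [wd xit E]]] := riccati_payoff_attained x s0 sT.
apply: ereal_sup_ubound; exists w, xi; split=> //.
by rewrite (running_payoffE wd mus xit s0) /quad -EFinD E.
Qed.

End RiccatiSemigroup.

(** * Invariance of the matrix interval along every Riccati solution *)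

Section FlowInvariance.
Context {R : realType} {M n k : nat} (S : lq_data R M n k).
Variables (lo hi : 'M[R]_n).
Hypothesis inv : forall (m : 'I_M) (t : R) (P0 : 'M[R]_n), 0 <= t ->
  loewner_itv lo hi P0 ->
  exists2 Q : 'M[R]_n, riccati_flow S m t P0 Q & loewner_itv lo hi Q.

(* Solutions are unique because they represent the semigroup, so the
   invariance granted for some solution holds for all of them. *)
Lemma riccati_solution_itv m P0 T P s : loewner_itv lo hi P0 ->
  riccati_solution S m P0 T P -> 0 <= s -> (s%:E < T)%E ->
  loewner_itv lo hi (P s).
Proof.
move=> P0i solP s0 sT.
have [Q [T' [P' [[solP' _] sT' QE]]] [symQ loQ Qhi]] := inv m s0 P0i.
have E x : qform (P s) x = qform Q x.
  have := semigroup_quad solP x s0 sT.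
  rewrite (semigroup_quad solP' x s0 sT') /quad QE => -[].
  by move=> /mulfI => ->.
split; first exact: riccati_sym solP _ s0 sT.
- by move=> x; rewrite E.
- by move=> x; rewrite E.
Qed.

End FlowInvariance.

(** * One step of the method against arbitrary switchings *)

Section EntryBounds.
Context {R : realType}.

(** Entrywise bounds play the part of a norm, since integrals and mean values are taken entry by
    entry; the price is a dimension factor per product. *)
Definition bnd p q (c : R) (X : 'M[R]_(p, q)) : Prop := forall i j, `|X i j| <= c.

Lemma bnd_sum p q (X : 'M[R]_(p, q)) : bnd (\sum_i \sum_j `|X i j|) X.
Proof.
move=> i j; rewrite (bigD1 i)//= (bigD1 j)//= -addrA lerDl addr_ge0 ?sumr_ge0//.
by move=> l _; rewrite sumr_ge0.
Qed.

Lemma bnd_le p q c d (X : 'M[R]_(p, q)) : bnd c X -> c <= d -> bnd d X.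
Proof. by move=> Xc cd i j; apply: le_trans cd. Qed.

Lemma bnd_tr p q c (X : 'M[R]_(p, q)) : bnd c X -> bnd c X^T.
Proof. by move=> Xc i j; rewrite mxE. Qed.

Lemma bndD p q c d (X Y : 'M[R]_(p, q)) : bnd c X -> bnd d Y -> bnd (c + d) (X + Y).
Proof. by move=> Xc Yd i j; rewrite mxE (le_trans (ler_normD _ _))// lerD. Qed.

Lemma bndZ p q a c (X : 'M[R]_(p, q)) : bnd c X -> bnd (`|a| * c) (a *: X).
Proof. by move=> Xc i j; rewrite mxE normrM ler_wpM2l. Qed.

Lemma bndM p q r c d (X : 'M[R]_(p, q)) (Y : 'M[R]_(q, r)) :
  bnd c X -> bnd d Y -> bnd (q%:R * (c * d)) (X *m Y).
Proof.
move=> Xc Yd i j; rewrite mxE (le_trans (ler_norm_sum _ _ _))//.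
rewrite (@le_trans _ _ (\sum_(l < q) c * d))//.
  by apply: ler_sum => l _; rewrite normrM ler_pM.
by rewrite sumr_const card_ord -[leLHS]mulr_natl.
Qed.

Lemma bnd_scalar n c a : `|a| <= c -> bnd c (a%:M : 'M[R]_n).
Proof.
move=> ac i j; rewrite mxE; case: (i == j); rewrite ?mulr1n ?mulr0n//.
by rewrite normr0 (le_trans _ ac).
Qed.

Lemma qform_bnd n c (X : 'M[R]_n) x : bnd c X ->
  `|qform X x| <= n%:R * c * enorm x ^+ 2.
Proof.
move=> Xc; rewrite qformE dotE (le_trans (ler_norm_sum _ _ _))//.
(* The arithmetic-geometric mean inequality; each of the two squares is then counted [n] times,
   whence the factor [n]. *)
have key i j : `|x i 0 * (X i j * x j 0)| <= c * (2^-1 * (x i 0 ^+ 2 + x j 0 ^+ 2)).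
  rewrite mulrCA normrM ler_pM//.
  have := sqr_ge0 (`|x i 0| - `|x j 0|).
  rewrite normrM -(real_normK (num_real (x i 0))) -(real_normK (num_real (x j 0))).
  rewrite sqrrB; lra.
rewrite (@le_trans _ _ (\sum_i \sum_j c * (2^-1 * (x i 0 ^+ 2 + x j 0 ^+ 2))))//.
  apply: ler_sum => i _; rewrite mxE mulr_sumr (le_trans (ler_norm_sum _ _ _))//.
  by apply: ler_sum => j _; exact: key.
rewrite le_eqVlt; apply/orP; left; apply/eqP.
rewrite enorm_sqr dotE.
under eq_bigr do rewrite -mulr_sumr -mulr_sumr big_split /= sumr_const card_ord.
rewrite -mulr_sumr -mulr_sumr big_split /= sumr_const card_ord sumrMnl.
rewrite (eq_bigr (fun i => x i 0 * x i 0)); last by move=> i _; rewrite expr2.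
set s := \sum_i _; rewrite -(mulr_natl s n); by field.
Qed.

Lemma enorm_delta n (j : 'I_n) : enorm (delta_mx j 0 : 'cV[R]_n) ^+ 2 = 1.
Proof.
rewrite enorm_sqr dotE (bigD1 j)//= big1 => [|i ij].
  by rewrite !mxE !eqxx mulr1 addr0.
by rewrite !mxE (negbTE ij) mul0r.
Qed.

(** Column j is the image of the j-th basis vector, whose Euclidean norm is at most [l] by
    [loewner_sqr]. *)
Lemma loewner_itv_bnd n l (P : 'M[R]_n) : 0 < l -> P \is symmetricmx ->
  loewner_le 0 P -> loewner_le P l%:M -> bnd l P.
Proof.
move=> l0 symP P0 Pl i j.
have := loewner_sqr (delta_mx j 0) symP l0 P0 Pl.
rewrite -!enorm_sqr enorm_delta mulr1 ler_sqr ?nnegrE ?enorm_ge0 ?(ltW l0)// => h.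
have := coord_le_enorm (P *m delta_mx j 0) i.
by rewrite -colE mxE => /le_trans; apply; move: h; rewrite -colE.
Qed.

Lemma ac_increment_le (a b c u v : R) (f f' : R -> R) : ac a b f f' ->
  a <= u -> u <= v -> v <= b -> (forall t, a <= t <= b -> f' t <= c) ->
  f v - f u <= c * (v - u).
Proof.
move=> acf au uv vb fc; rewrite (ac_diff acf au uv vb).
have iuv := integrable_itvS au vb acf.1.
have iN : (@lebesgue_measure R).-integrable `[u, v] (EFin \o (fun t => -1 * f' t)).
  exact: (integrableZl _ _ iuv).
have := ge_Rintegral (c := - c) uv iN; rewrite RintegralZl//.
rewrite mulNr mulN1r lerN2; apply => t /andP[ut tv].
by rewrite mulN1r lerN2 fc// (le_trans au ut) (le_trans (ltW tv)).
Qed.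

Lemma ac_increment_bound (a b c u v : R) (f f' : R -> R) : ac a b f f' ->
  a <= u -> u <= v -> v <= b -> (forall t, a <= t <= b -> `|f' t| <= c) ->
  `|f v - f u| <= c * (v - u).
Proof.
move=> acf au uv vb fc; rewrite ler_norml; apply/andP; split.
  have h : -1 * f v - -1 * f u <= c * (v - u).
    apply: (ac_increment_le (acZ (-1) acf)) => // t tab.
    by rewrite mulN1r (le_trans (ler_norm _))// normrN fc.
  by lra.
apply: (ac_increment_le acf) => // t tab.
by rewrite (le_trans (ler_norm _))// fc.
Qed.

End EntryBounds.

Section RiccatiField.
Context {R : realType} {M n k : nat} (S : lq_data R M n k).
Notation Phi := (riccati_field S).

Lemma riccati_field_sym m P : P \is symmetricmx -> Phi m P \is symmetricmx.
Proof.
move=> symP; rewrite /riccati_field; apply: symmetricD (lq_D_sym S m).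
have /symmetric_tr EP := symP.
apply: symmetricD.
  by rewrite symmetricmxE linearD /= !trmx_mul trmxK EP addrC.
rewrite symmetricmxE !trmx_mul EP mulmxA; apply/eqP; congr (_ *m _ *m _).
by rewrite /lq_Sigma linearZ /= trmx_mul trmxK.
Qed.

(** The field is affine apart from the term P Sigma P with Sigma positive semidefinite; the
    convexity defect is [theta (1 - theta)] times gamma^-2 |sigma'(P - Q)x|^2. *)
Lemma riccati_field_convex m P Q theta x :
  P \is symmetricmx -> Q \is symmetricmx -> 0 <= theta <= 1 ->
  qform (Phi m ((1 - theta) *: P + theta *: Q)) x <=
    (1 - theta) * qform (Phi m P) x + theta * qform (Phi m Q) x.
Proof.
move=> symP symQ /andP[t0 t1].
rewrite !qform_riccati_field//; last first.
  by apply: symmetricD; exact: symmetricZ.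
rewrite mulmxDl -!scalemxAl !mulmxDr -!scalemxAr.
set u := (lq_sigma S m)^T *m (P *m x); set v := (lq_sigma S m)^T *m (Q *m x).
have g0 : 0 <= (lq_gamma S ^+ 2)^-1 by rewrite invr_ge0 exprn_ge0// ltW// lq_gamma_gt0.
have : 0 <= (lq_gamma S ^+ 2)^-1 * (theta * (1 - theta) * dot (u - v) (u - v)).
  by rewrite !mulr_ge0 ?dot_ge0// subr_ge0.
rewrite !(dotBl, dotBr, dotDl, dotDr, dotZl, dotZr) (dotC v u).
set g := (_ ^+ 2)^-1; lra.
Qed.

(** [L0] bounds the field and [L1] is a Lipschitz constant on the ball of radius [r], uniformly in
    the mode because the data are summed over all modes. With [e <= 1] the quadratic term in [E] is
    estimated linearly. *)
Lemma riccati_field_bounds r : 0 <= r -> exists L0 L1,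
  [/\ 0 < L0, 0 < L1, forall m P, bnd r P -> bnd L0 (Phi m P) &
  forall m P E e, bnd r P -> bnd e E -> 0 <= e <= 1 ->
    bnd (L1 * e) (Phi m (P + E) - Phi m P)].
Proof.
move=> r0.
pose a := \sum_m \sum_i \sum_j `|lq_A S m i j|.
pose s := \sum_m \sum_i \sum_j `|lq_Sigma S m i j|.
pose d := \sum_m \sum_i \sum_j `|lq_D S m i j|.
have a0 : 0 <= a by do 3 apply: sumr_ge0 => ? _.
have s0 : 0 <= s by do 3 apply: sumr_ge0 => ? _.
have d0 : 0 <= d by do 3 apply: sumr_ge0 => ? _.
have sum_le (F : 'I_M -> R) m : (forall m, 0 <= F m) -> F m <= \sum_m F m.
  by move=> F0; rewrite (bigD1 m)//= lerDl sumr_ge0.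
have Aa m : bnd a (lq_A S m).
  by apply: bnd_le (bnd_sum _) _; apply: sum_le => m'; do 2 apply: sumr_ge0 => ? _.
have Ss m : bnd s (lq_Sigma S m).
  by apply: bnd_le (bnd_sum _) _; apply: sum_le => m'; do 2 apply: sumr_ge0 => ? _.
have Dd m : bnd d (lq_D S m).
  by apply: bnd_le (bnd_sum _) _; apply: sum_le => m'; do 2 apply: sumr_ge0 => ? _.
have nn : 0 <= n%:R :> R by [].
pose L0 := n%:R * (a * r) + n%:R * (r * a) + n%:R * (n%:R * (r * s) * r) + d.
pose L1 := n%:R * a + n%:R * a + (n%:R * (n%:R * s * (r + 1)) + n%:R * (n%:R * (r * s))).
have L00 : 0 <= L0 by rewrite /L0 !addr_ge0 ?mulr_ge0.
have L10 : 0 <= L1 by rewrite /L1 !addr_ge0 ?mulr_ge0 ?addr_ge0.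
(* Adding 1 makes both constants strictly positive, also in dimension 0. *)
exists (L0 + 1), (L1 + 1); split; [by rewrite ltr_wpDl..| |].
  move=> m P Pr; apply: (@bnd_le _ _ _ L0); last by rewrite lerDl.
  apply: bndD (Dd m); apply: bndD; last first.
    by apply: bndM => //; apply: bndM => //.
  by apply: bndD; apply: bndM => //; exact: bnd_tr.
move=> m P E e Pr Ee /andP[e0 e1].
have -> : Phi m (P + E) - Phi m P = (lq_A S m)^T *m E + E *m lq_A S m +
    (E *m lq_Sigma S m *m (P + E) + P *m lq_Sigma S m *m E).
  rewrite /riccati_field !(mulmxDl, mulmxDr).
  move: (_ *m P) (_ *m E) (P *m lq_A S m) (E *m lq_A S m) => x1 x2 x3 x4.
  move: (P *m _ *m P) (P *m _ *m E) (E *m _ *m P) (E *m _ *m E) => x5 x6 x7 x8.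
  apply/matrixP => i j; rewrite !mxE; ring.
apply: bnd_le; first apply: bndD; first apply: bndD; first apply: bndM (bnd_tr (Aa m)) Ee.
- exact: bndM Ee (Aa m).
- apply: bndD; first exact: bndM (bndM Ee (Ss m)) (bndD Pr Ee).
  exact: bndM (bndM Pr (Ss m)) Ee.
rewrite /L1.
have h : n%:R * (n%:R * (e * s) * (r + e)) <= n%:R * (n%:R * s * (r + 1)) * e.
  have : 0 <= n%:R * (n%:R * s) * e * (1 - e).
    by rewrite !mulr_ge0// subr_ge0.
  by lra.
by lra.
Qed.

End RiccatiField.

Lemma mxBE (V : zmodType) p q (X Y : 'M[V]_(p, q)) i j :
  (X - Y) i j = X i j - Y i j.
Proof. by rewrite !mxE. Qed.

Lemma mxZE (V : pzRingType) p q a (X : 'M[V]_(p, q)) i j :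
  (a *: X) i j = a * X i j.
Proof. by rewrite mxE. Qed.

Section OneStep.
Context {R : realType} {M n k : nat} (S : lq_data R M n k).
Notation leb := (@lebesgue_measure R).
Notation Phi := (riccati_field S).
Variables lambda lambda' eps delta L0 L1 : R.
Hypotheses (eps_gt0 : 0 < eps) (lambda_gt0 : 0 < lambda) (ltl : lambda < lambda').
Hypothesis delta_gt0 : 0 < delta.
Notation I := (loewner_itv (eps%:M : 'M[R]_n) lambda%:M).
Hypothesis inv : forall (m : 'I_M) (t : R) (P0 : 'M[R]_n), 0 <= t -> I P0 ->
  exists2 Q : 'M[R]_n, riccati_flow S m t P0 Q & I Q.
Hypothesis super : forall m x,
  qform (Phi m lambda'%:M) x <= - delta * enorm x ^+ 2.
Hypotheses (L0_gt0 : 0 < L0) (L1_gt0 : 0 < L1).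
Hypothesis L0P : forall m P, bnd lambda' P -> bnd L0 (Phi m P).
Hypothesis L1P : forall m P E e, bnd lambda' P -> bnd e E -> 0 <= e <= 1 ->
  bnd (L1 * e) (Phi m (P + E) - Phi m P).

Lemma itv_qform_ge0 P x : I P -> 0 <= qform P x.
Proof.
move=> [_ eP _]; apply: le_trans (eP x).
by rewrite qform_scalar mulr_ge0 ?sqr_ge0 ?ltW.
Qed.

Lemma itv_bnd P : I P -> bnd lambda P.
Proof.
move=> PI; have [symP _ Pl] := PI; apply: loewner_itv_bnd => // x.
by rewrite qform_eq0; exact: itv_qform_ge0.
Qed.

Let itv_bnd' P : I P -> bnd lambda' P.
Proof. by move=> /itv_bnd Pl; apply: bnd_le Pl (ltW ltl). Qed.

Lemma riccati_flow_itv m s P0 Q : 0 <= s -> I P0 -> riccati_flow S m s P0 Q -> I Q.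
Proof.
move=> s0 P0I [T [P [[solP _] sT <-]]].
exact: (riccati_solution_itv inv P0I solP s0 sT).
Qed.

(** The mean value theorem is used twice: the solution moves by at most [L0 s], so the field along
    it differs from its initial value by at most [L1 L0 s], and the first-order error is quadratic
    in [s]. *)
Lemma riccati_flow_increment m s P0 Q : 0 < s -> L0 * s <= 1 -> I P0 ->
  riccati_flow S m s P0 Q ->
  bnd (L1 * (L0 * s) * s) (Q - P0 - s *: Phi m P0).
Proof.
move=> s0 s1 P0I [T [P [[solP _] sT <-]]].
have PI c : 0 <= c <= s -> I (P c).
  move=> /andP[c0 cs]; apply: (riccati_solution_itv inv P0I solP c0).
  by apply: le_lt_trans sT; rewrite lee_fin.
have incr c : 0 < c <= s -> bnd (L0 * s) (P c - P0).
  move=> /andP[c0 cs] i j.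
  have cT : (c%:E < T)%E by apply: le_lt_trans sT; rewrite lee_fin.
  have [c' /andP[c'0 c'c] E] := riccati_mean_value solP i j c0 cT.
  rewrite mxBE E normrM (gtr0_norm c0) mulrC ler_pM//.
    by rewrite ltW.
  by apply: L0P; apply: itv_bnd'; apply: PI; rewrite (ltW c'0) (le_trans (ltW c'c)).
move=> i j; have [c /andP[c0 cs] E] := riccati_mean_value solP i j s0 sT.
have := L1P m (itv_bnd' P0I) (incr c _).
rewrite c0 (ltW cs) mulr_ge0 ?(ltW L0_gt0) ?(ltW s0) ?s1//.
move=> /(_ isT isT i j); rewrite [P0 + _]addrC subrK mxBE => h.
rewrite !mxBE E mxZE -mulrBr normrM (gtr0_norm s0) mulrC.
by rewrite ler_wpM2r ?(ltW s0).
Qed.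

(** [K1 tau] is the price, as a quadratic form, of perturbing the argument of the field by
    [(L0 + delta + 1) tau]. The constant [K] below adds the second-order error of the flow itself;
    the total cost of a step is [K tau^2]. *)
Let K1 : R := n%:R * L1 * (L0 + delta + 1).
Let K : R := n%:R * L1 * L0 + K1.

(** After positivity: the perturbation stays below 1, so that the Lipschitz bound applies; the slack
    [rho] is bounded by [delta + 1]; the last two conditions keep the comparison path
    nonnegative. *)
Definition small_step (tau : R) : Prop :=
  [/\ 0 < tau, (L0 + delta + 1) * tau <= 1, K1 * tau <= 1,
      n%:R * L0 * tau <= eps & delta * tau <= lambda'].

Section Step.
Variables (tau theta : R) (P : 'M[R]_n).
Variables (x : 'cV[R]_n) (w : R -> 'cV[R]_k) (mu : R -> 'I_M) (xi : R -> 'cV[R]_n).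
Variable a : R.
Hypothesis tau_small : small_step tau.
Hypothesis theta01 : 0 <= theta <= 1.
Hypothesis PI : I P.
Hypotheses (wd : disturbance w) (mus : switching mu).
Hypothesis xit : trajectory S x w mu xi.
Hypothesis a0 : 0 <= a.

Let b : R := a + tau.
(** Net slack: the gain [theta delta] from convexity minus the linearization error. It may be
    negative. *)
Let rho : R := theta * delta - K1 * tau.
Let G (t : R) : 'M[R]_n := \matrix_(i, j) \int[leb]_(s in `[a, t]) Phi (mu s) P i j.
(** The comparison path ends at [b] in the relaxed matrix. Backwards in time it follows the field of
    the actual switching frozen at [P], weighted by [1 - theta], while the scalar term spends the
    slack. Its density [Y'] is only measurable in time. *)
Let Y (t : R) : 'M[R]_n :=
  ((1 - theta) *: P + theta *: lambda'%:M) +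
    ((1 - theta) *: (G b + -1 *: G t) + (rho * (t - b))%:M).
Let Y' (t : R) : 'M[R]_n := - (1 - theta) *: Phi (mu t) P + rho%:M.

Let tau0 : 0 < tau. Proof. by case: tau_small. Qed.
Let ab : a <= b. Proof. by rewrite /b lerDl ltW. Qed.
Let nn : 0 <= n%:R :> R. Proof. by []. Qed.
Let K10 : 0 <= K1.
Proof.
by rewrite /K1 !mulr_ge0 ?addr_ge0// ltW.
Qed.

Let macG : mac a b G (fun t => Phi (mu t) P).
Proof.
move=> i j; split.
  apply: (bounded_integrable (m := L0)); last first.
    by move=> t _; apply: L0P; exact: itv_bnd'.
  apply: (measurable_switch mus (g := fun m _ => Phi m P i j)) => //.
  by apply: subset_itv; rewrite bnd_simp.
move=> t /andP[aT tb]; rewrite /G !mxE set_itv1 Rintegral_set1 add0r//.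
Qed.

Let Ga : G a = 0.
Proof. by apply/matrixP => i j; rewrite !mxE set_itv1 Rintegral_set1. Qed.

Let macY : mac a b Y Y'.
Proof.
have macs : mac a b (fun t => (rho * (t - b))%:M : 'M[R]_n) (fun=> rho%:M).
  move=> i j; apply: (@eq_ac _ _ _ (fun t => rho * (t - b) *+ (i == j)) _
      (fun=> rho *+ (i == j))) => [t _|t _|]; rewrite ?mxE//.
  apply: ac_FTC => [t _|t _|t _].
  - case: (i == j); rewrite ?mulr1n ?mulr0n; last exact: cst_continuous.
    apply: continuousM; first exact: cst_continuous.
    by apply: continuousB; [exact: cvg_id|exact: cst_continuous].
  - exact: cst_continuous.
  case: (i == j); rewrite ?mulr1n ?mulr0n; last exact: is_derive_cst.
  rewrite -[X in is_derive _ _ _ X]mulr1; apply: is_deriveZ.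
  rewrite -[X in is_derive _ _ _ X]subr0; apply: is_deriveB.
move=> i j.
apply: eq_ac (macD (mac_cst a b ((1 - theta) *: P + theta *: lambda'%:M))
  (macD (macZ (1 - theta) (macD (mac_cst a b (G b)) (macZ (-1) macG))) macs) i j) => //.
by move=> t _; rewrite /Y' !mxE; ring.
Qed.

Let symP : P \is symmetricmx. Proof. by case: PI. Qed.

Let symG t : G t \is symmetricmx.
Proof.
rewrite symmetricmxE; apply/eqP/matrixP => i j; rewrite !mxE.
apply: eq_Rintegral => s _.
by rewrite -[in LHS](symmetric_tr (riccati_field_sym S (mu s) symP)) mxE.
Qed.

Let symY t : Y t \is symmetricmx.
Proof.
apply: symmetricD.
  apply: symmetricD; first exact: symmetricZ.
  by apply: symmetricZ; exact: symmetric_scalar.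
apply: symmetricD; last exact: symmetric_scalar.
by apply: symmetricZ; apply: symmetricD; [exact: symG|apply: symmetricZ; exact: symG].
Qed.

Let GbGt t : a <= t <= b -> bnd (L0 * (b - t)) (G b + -1 *: G t).
Proof.
move=> /andP[aT tb] i j; rewrite !mxE mulN1r.
have := ac_increment_bound (macG i j) aT tb (lexx b) (c := L0).
rewrite !mxE; apply => s _; apply: L0P; exact: itv_bnd'.
Qed.

Let rho_bound : `|rho| <= delta + 1.
Proof.
have [_ _ k1 _ _] := tau_small; have /andP[t0 t1] := theta01.
have h : 0 <= K1 * tau by rewrite mulr_ge0// ltW.
have h2 : 0 <= theta * delta by rewrite mulr_ge0// ltW.
have h3 : 0 <= (1 - theta) * delta by rewrite mulr_ge0 ?subr_ge0// ltW.
by rewrite ler_norml /rho; apply/andP; split; lra.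
Qed.

(** Convexity bounds the field at the relaxed matrix by [(1 - theta) Phi(P) - theta delta], and
    moving from there to [Y t] costs at most [K1 tau]. The first term cancels against [Y'], and
    [rho] balances the other two exactly. *)
Let superY t z : a <= t <= b -> qform (Y' t + Phi (mu t) (Y t)) z <= 0.
Proof.
move=> tab; have [_ small1 _ _ _] := tau_small; have /andP[t0 t1] := theta01.
have /andP[aT tb] := tab.
pose e := (L0 + delta + 1) * tau.
have bt : 0 <= b - t <= tau by rewrite subr_ge0 tb /= /b; lra.
have /andP[bt0 btt] := bt.
have Ee : bnd e ((1 - theta) *: (G b + -1 *: G t) + (rho * (t - b))%:M).
  rewrite /e -addrA mulrDl; apply: bndD.
    apply: bnd_le (bndZ (1 - theta) (GbGt tab)) _.
    rewrite ger0_norm ?subr_ge0// (@le_trans _ _ (L0 * (b - t)))//.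
      by rewrite ler_piMl ?mulr_ge0 ?(ltW L0_gt0)// lerBlDr lerDl.
    by rewrite ler_wpM2l// ltW.
  apply: bnd_scalar; rewrite normrM [X in _ * X]distrC (ger0_norm bt0).
  by rewrite ler_pM.
have Y0b : bnd lambda' ((1 - theta) *: P + theta *: lambda'%:M).
  apply: (@bnd_le _ _ _ (`|1 - theta| * lambda' + `|theta| * lambda')).
    apply: bndD; apply: bndZ; first exact: itv_bnd'.
    by apply: bnd_scalar; rewrite gtr0_norm// (lt_trans lambda_gt0).
  rewrite !ger0_norm ?subr_ge0//; lra.
have e0 : 0 <= e by rewrite /e mulr_ge0 ?addr_ge0// ltW.
have e01 : 0 <= e <= 1 by rewrite e0.
have h1 := qform_bnd z (L1P (mu t) Y0b Ee e01).
have h2 := riccati_field_convex S (mu t) z symP (symmetric_scalar n lambda') theta01.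
have h3 : theta * qform (Phi (mu t) lambda'%:M) z <= theta * (- delta * enorm z ^+ 2).
  by rewrite ler_wpM2l// super.
have {}h1 := le_trans (ler_norm _) h1; rewrite qformB in h1.
rewrite qformD /Y' qformD qformZ qform_scalar.
rewrite -/(Y t) in h1.
have K1E : n%:R * (L1 * e) = K1 * tau by rewrite /e /K1; ring.
rewrite K1E in h1.
have rhoE : rho * enorm z ^+ 2 = theta * delta * enorm z ^+ 2 - K1 * tau * enorm z ^+ 2.
  by rewrite /rho; ring.
rewrite rhoE; lra.
Qed.

Let Yb : Y b = (1 - theta) *: P + theta *: lambda'%:M.
Proof.
rewrite /Y scaleN1r subrr scaler0 add0r subrr mulr0.
by rewrite raddf0 addr0.
Qed.

Lemma one_step_payoff u : a <= u <= b ->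
  \int[leb]_(t in `[a, u]) payoff_rate S (mu t) (xi t) (w t)
    + 2^-1 * qform (Y u) (xi u) <= 2^-1 * qform (Y a) (xi a).
Proof.
move=> /andP[au ub].
apply: (verification_le wd mus xit a0 au (macS macY (lexx a) ub)) => // t /andP[aT tu].
by apply: superY; rewrite aT (le_trans tu).
Qed.

(** The bound [eps] below [P] absorbs the drift of [G], and [theta lambda'] absorbs the scalar term.
    This permits stopping the payoff at any time [u] of the step. *)
Let Y_ge0 u z : a <= u <= b -> 0 <= qform (Y u) z.
Proof.
move=> uab; have [_ _ _ small3 small4] := tau_small; have /andP[t0 t1] := theta01.
have /andP[au ub] := uab.
rewrite /Y !qformD !qformZ !qform_scalar qformD qformZ.
have h1 : eps * enorm z ^+ 2 <= qform P z.
  by have [_ eP _] := PI; have := eP z; rewrite qform_scalar.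
have h2 := qform_bnd z (GbGt uab).
rewrite ler_norml in h2; have /andP[{}h2 _] := h2.
rewrite qformD qformZ in h2.
have z0 : 0 <= enorm z ^+ 2 by rewrite sqr_ge0.
have bu : 0 <= b - u <= tau by rewrite subr_ge0 ub /= /b; lra.
have /andP[bu0 but] := bu.
have h3 : n%:R * (L0 * (b - u)) <= eps.
  apply: le_trans small3; rewrite mulrA ler_wpM2l// mulr_ge0// ltW//.
have h4 : n%:R * (L0 * (b - u)) * enorm z ^+ 2 <= eps * enorm z ^+ 2.
  by rewrite ler_wpM2r.
have h5 : rho * (b - u) <= theta * lambda'.
  apply: (@le_trans _ _ (theta * delta * (b - u))).
    by rewrite ler_wpM2r// /rho gerBl mulr_ge0// ltW.
  rewrite -mulrA ler_wpM2l// (le_trans _ small4)// ler_wpM2l// ltW//.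
have h6 : rho * (b - u) * enorm z ^+ 2 <= theta * lambda' * enorm z ^+ 2.
  by rewrite ler_wpM2r.
have h7 : 0 <= (1 - theta) * (qform P z + (qform (G b) z + -1 * qform (G u) z)).
  by rewrite mulr_ge0 ?subr_ge0//; lra.
lra.
Qed.

(** The second premise is the discrete relaxation law: the decrease of [theta] is paid by the slack
    minus the step cost. The first conclusion links consecutive steps; the second covers a horizon
    that ends inside the step. *)
Lemma one_step theta' : 0 <= theta' <= theta ->
  (theta - theta') * lambda' <= theta * delta * tau - K * tau ^+ 2 ->
  exists m, forall Q, riccati_flow S m tau P Q ->
  let B := (1 - theta') * (2^-1 * qform Q (xi a))
    + theta' * (2^-1 * (lambda' * enorm (xi a) ^+ 2)) in
  \int[leb]_(t in `[a, b]) payoff_rate S (mu t) (xi t) (w t)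
    + ((1 - theta) * (2^-1 * qform P (xi b))
       + theta * (2^-1 * (lambda' * enorm (xi b) ^+ 2))) <= B /\
  (forall u, a <= u <= b ->
    \int[leb]_(t in `[a, u]) payoff_rate S (mu t) (xi t) (w t) <= B).
Proof.
move=> /andP[th0 thth] thE; have /andP[t0 t1] := theta01.
have [_ small1 _ _ _] := tau_small.
set z := xi a.
(* The replacement mode is the best one for the single vector [z], the state at the start of the
   step. *)
have [m _ mmax] := @Order.TotalTheory.arg_maxP _ R 'I_M (mu a) predT
  (fun m => qform (Phi m P) z) isT.
exists m => Q flowQ B.
have QI := riccati_flow_itv (ltW tau0) PI flowQ.
have tL0 : L0 * tau <= 1.
  apply: le_trans small1; rewrite ler_wpM2r ?(ltW tau0)// -addrA lerDl addr_ge0// ltW//.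
have z0 : 0 <= enorm z ^+ 2 by rewrite sqr_ge0.
have q1 := qform_bnd z (riccati_flow_increment tau0 tL0 PI flowQ).
rewrite ler_norml !qformB qformZ in q1; have /andP[{}q1 _] := q1.
(* With the test vector fixed, the integrated frozen field is at most [tau] times its largest value
   over the modes, whatever the switching does. *)
have q2 : qform (G b) z <= tau * qform (Phi m P) z.
  have acq := mac_qform macG (mac_cst a b z).
  have := ac_increment_le (c := qform (Phi m P) z) acq (lexx a) ab (lexx b).
  rewrite Ga qform_eq0 subr0 (_ : b - a = tau); last by rewrite /b; ring.
  rewrite mulrC; apply => t _.
  by rewrite trmx0 !mul0mx !mulmx0 !mxE addr0 addr0; exact: mmax.
have q3 := itv_qform_ge0 z QI.
have Ya : qform (Y a) z = (1 - theta) * (qform P z + qform (G b) z) +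
    (theta * lambda' - rho * tau) * enorm z ^+ 2.
  rewrite /Y Ga !(qformD, qformZ, qform_scalar, qform_eq0) /b; ring.
have key : qform (Y a) z <= 2 * B.
  rewrite Ya /B.
  have e1 : (1 - theta) * (qform P z + qform (G b) z) <=
     (1 - theta) * (qform Q z + n%:R * (L1 * (L0 * tau) * tau) * enorm z ^+ 2).
    by rewrite ler_wpM2l ?subr_ge0//; lra.
  have e2 : (1 - theta) * (n%:R * (L1 * (L0 * tau) * tau) * enorm z ^+ 2) <=
      n%:R * (L1 * (L0 * tau) * tau) * enorm z ^+ 2.
    have X0 : 0 <= n%:R * (L1 * (L0 * tau) * tau) * enorm z ^+ 2.
      have ht := ltW tau0; have hL := ltW L0_gt0; have hL' := ltW L1_gt0.
      exact: mulr_ge0 (mulr_ge0 nn (mulr_ge0 (mulr_ge0 hL' (mulr_ge0 hL ht)) ht)) z0.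
    have := mulr_ge0 t0 X0; lra.
  have e3 : (theta - theta') * lambda' * enorm z ^+ 2 <=
      (theta * delta * tau - K * tau ^+ 2) * enorm z ^+ 2 by rewrite ler_wpM2r.
  (* Positivity of [Q] lets its weight grow from [1 - theta] to [1 - theta']. *)
  have e4 : 0 <= (theta - theta') * qform Q z by rewrite mulr_ge0 ?subr_ge0.
  have rE : (theta * lambda' - rho * tau) * enorm z ^+ 2 =
    theta * lambda' * enorm z ^+ 2 - (theta * delta * tau - K * tau ^+ 2) * enorm z ^+ 2
      - n%:R * (L1 * (L0 * tau) * tau) * enorm z ^+ 2.
    by rewrite /rho /K; ring.
  rewrite rE; lra.
split.
  have := one_step_payoff (u := b); rewrite ab lexx Yb => /(_ isT).
  rewrite qformD !qformZ qform_scalar -/z; lra.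
move=> u uab; have := one_step_payoff uab; have := Y_ge0 (xi u) uab.
rewrite -/z; lra.
Qed.

End Step.
End OneStep.

(** * Bounds on the value function *)

Section Reach.
Context {R : realType} {M n k : nat} (S : lq_data R M n k).

(** Compositions of [j] Riccati flows, as a set because [riccati_flow] is a relation. The flow
    applied last governs the earliest time step. *)
Fixpoint reach (tau : R) (P0 : 'M[R]_n) (j : nat) : set 'M[R]_n :=
  if j is j'.+1
  then [set Q | exists m P, reach tau P0 j' P /\ riccati_flow S m tau P Q]
  else [set P0].

End Reach.

Section UpperBound.
Context {R : realType} {M n k : nat} (S : lq_data R M n k).
Notation leb := (@lebesgue_measure R).
Notation Phi := (riccati_field S).
Variables lambda lambda' eps delta : R.
Hypotheses (eps_gt0 : 0 < eps) (lambda_gt0 : 0 < lambda) (ltl : lambda < lambda').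
Hypothesis delta_gt0 : 0 < delta.
Notation I := (loewner_itv (eps%:M : 'M[R]_n) lambda%:M).
Hypothesis inv : forall (m : 'I_M) (t : R) (P0 : 'M[R]_n), 0 <= t -> I P0 ->
  exists2 Q : 'M[R]_n, riccati_flow S m t P0 Q & I Q.
Hypothesis super : forall m x,
  qform (Phi m lambda'%:M) x <= - delta * enorm x ^+ 2.

Lemma reach_itv tau P0 j Q : 0 <= tau -> I P0 -> reach S tau P0 j Q -> I Q.
Proof.
move=> tau0 P0I; elim: j Q => [|j IH] Q /=; first by move=> ->.
by move=> [m [P [/IH PI flowQ]]]; apply: (riccati_flow_itv inv tau0 PI flowQ).
Qed.

(** The constant path [lambda' I] is a supersolution for every mode, so it bounds the payoff over
    any horizon; this starts the induction at [theta = 1] and shows that the value is finite. *)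
Lemma super_payoff x w mu xi a T :
  disturbance w -> switching mu -> trajectory S x w mu xi -> 0 <= a -> a <= T ->
  \int[leb]_(t in `[a, T]) payoff_rate S (mu t) (xi t) (w t)
    <= 2^-1 * (lambda' * enorm (xi a) ^+ 2).
Proof.
move=> wd mus xit a0 aT.
have symY t : a <= t <= T -> (lambda'%:M : 'M[R]_n) \is symmetricmx.
  by move=> _; exact: symmetric_scalar.
have := verification_le wd mus xit a0 aT (mac_cst a T lambda'%:M) symY.
rewrite !qform_scalar => h.
have {}h := h _.
have l'0 : 0 <= 2^-1 * (lambda' * enorm (xi T) ^+ 2).
  by rewrite mulr_ge0// mulr_ge0 ?sqr_ge0// ltW// (lt_trans lambda_gt0).
apply: le_trans (h _); first by rewrite lerDl.
move=> t _; rewrite add0r; apply: le_trans (super _ _) _.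
by rewrite mulNr oppr_le0 mulr_ge0 ?sqr_ge0// ltW.
Qed.

(** The solution, starting from 1, of the affine recursion with fixed point [kappa tau] and
    contraction factor [1 - beta tau]; it makes the premise of [one_step] hold. *)
Definition theta_up (kappa beta tau : R) (j : nat) : R :=
  kappa * tau + (1 - kappa * tau) * (1 - beta * tau) ^+ j.

(** Induction on [j], peeling off the earliest step. The horizon [T] is unrelated to [j tau]: time
    left after [j] steps is covered by [super_payoff], and a horizon inside a step by the second
    half of [one_step]. The matrix [Q] may depend on the trajectory. *)
Lemma upper_bound : exists tau0 kappa,
  [/\ 0 < tau0, 0 < kappa, kappa * tau0 <= 1, delta / lambda' * tau0 <= 1 &
  forall tau, 0 < tau <= tau0 -> forall (P0 : 'M[R]_n) x w mu xi j a T,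
    I P0 -> disturbance w -> switching mu -> trajectory S x w mu xi ->
    0 <= a -> a <= T ->
    let th := theta_up kappa (delta / lambda') tau j in
    exists2 Q, reach S tau P0 j Q &
    \int[leb]_(t in `[a, T]) payoff_rate S (mu t) (xi t) (w t)
      <= (1 - th) * (2^-1 * qform Q (xi a)) + th * (2^-1 * (lambda' * enorm (xi a) ^+ 2))].
Proof.
have l'0 : 0 < lambda' := lt_trans lambda_gt0 ltl.
have [L0 [L1 [L00 L10 L0P L1P]]] := riccati_field_bounds S (ltW l'0).
have nn : 0 <= n%:R :> R by [].
pose K1 : R := n%:R * L1 * (L0 + delta + 1).
pose K : R := n%:R * L1 * L0 + K1.
have K10 : 0 <= K1 by rewrite /K1 !mulr_ge0 ?addr_ge0// ltW.
have K0 : 0 <= K by rewrite /K addr_ge0// !mulr_ge0// ltW.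
pose kappa := (K + 1) / delta.
pose beta := delta / lambda'.
pose C := (L0 + delta + 1) + K1 + n%:R * L0 / eps + beta + kappa.
have beta0 : 0 < beta by rewrite divr_gt0.
have kappa0 : 0 < kappa by rewrite divr_gt0// ltr_wpDl.
have h1 : 0 <= n%:R * L0 / eps by rewrite divr_ge0 ?mulr_ge0// ltW.
have sum5 (u1 u2 u3 u4 u5 : R) : 0 <= u1 -> 0 <= u2 -> 0 <= u3 -> 0 <= u4 -> 0 < u5 ->
    let s := u1 + u2 + u3 + u4 + u5 in
    0 < s /\ [/\ u1 <= s, u2 <= s, u3 <= s, u4 <= s & u5 <= s].
  by move=> u10 u20 u30 u40 u50 /=; split; [lra|split; lra].
have [C0 [c1 c2 c3 c4 c5]] : 0 < C /\ [/\ L0 + delta + 1 <= C, K1 <= C,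
    n%:R * L0 / eps <= C, beta <= C & kappa <= C].
  by apply: sum5; rewrite ?addr_ge0// ltW.
have part c tau : 0 < tau -> tau <= C^-1 -> c <= C -> c * tau <= 1.
  move=> t0 tC cC; apply: (@le_trans _ _ (C * tau)); first by rewrite ler_wpM2r// ltW.
  by rewrite mulrC -ler_pdivlMr// mul1r.
have Ci0 : 0 < C^-1 by rewrite invr_gt0.
exists C^-1, kappa; split=> //.
- exact: part.
- exact: part.
move=> tau /andP[t0 tC] P0 x w mu xi j a T P0I wd mus xit a0 aT.
have kt : kappa * tau <= 1 by exact: part.
have bt : beta * tau <= 1 by exact: part.
have small : small_step (n := n) lambda' eps delta L0 L1 tau.
  split=> //.
  - exact: part.
  - exact: part.
  - have := part _ tau t0 tC c3.
    by rewrite mulrAC ler_pdivrMr// mul1r.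
  - have := bt; rewrite /beta mulrAC ler_pdivrMr// mul1r; exact.
have q01 : 0 <= 1 - beta * tau <= 1.
  by rewrite subr_ge0 bt lerBlDr lerDl mulr_ge0// ltW.
have /andP[q0 q1] := q01.
have kt0 : 0 <= kappa * tau by rewrite mulr_ge0// ltW.
have th01 i : 0 <= theta_up kappa beta tau i <= 1.
  have e0 := exprn_ge0 i q0.
  have e1 : (1 - beta * tau) ^+ i <= 1 by rewrite exprn_ile1.
  rewrite /theta_up; apply/andP; split.
    by rewrite addr_ge0// mulr_ge0// subr_ge0.
  have : (1 - kappa * tau) * (1 - beta * tau) ^+ i <= (1 - kappa * tau) * 1.
    by rewrite ler_wpM2l// subr_ge0.
  lra.
have thS i : theta_up kappa beta tau i.+1 <= theta_up kappa beta tau i.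
  rewrite /theta_up lerD2l ler_wpM2l ?subr_ge0// exprS ler_piMl// exprn_ge0//.
have thE i : (theta_up kappa beta tau i - theta_up kappa beta tau i.+1) * lambda' <=
    theta_up kappa beta tau i * delta * tau - K * tau ^+ 2.
  have -> : (theta_up kappa beta tau i - theta_up kappa beta tau i.+1) * lambda' =
     theta_up kappa beta tau i * delta * tau - (K + 1) * tau ^+ 2.
    rewrite /theta_up exprS /beta /kappa.
    by field; rewrite !gt_eqF.
  by rewrite lerD2l lerN2 ler_wpM2r ?sqr_ge0// lerDl.
elim: j a T a0 aT => [|j IH] a T a0 aT th.
  have th1 : th = 1 by rewrite /th /theta_up expr0; ring.
  exists P0 => //; rewrite th1 subrr mul0r add0r mul1r.
  exact: super_payoff wd mus xit a0 aT.
have at0 : 0 <= a + tau by rewrite addr_ge0// ltW.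
have step := one_step eps_gt0 lambda_gt0 ltl delta_gt0 inv super L00 L10 L0P L1P.
have tht : 0 <= th <= theta_up kappa beta tau j.
  by rewrite thS andbT; have /andP[] := th01 j.+1.
have [Tb|bT] := leP T (a + tau).
  (* Only a member of the reachable set is taken from the induction hypothesis; its payoff bound is
     dropped, since the horizon ends within this step. *)
  have [P Pr _] := IH a T a0 aT.
  have PI := reach_itv (ltW t0) P0I Pr.
  have [m mP] := step _ _ _ _ _ _ _ _ small (th01 j) PI wd mus xit a0 _ tht (thE j).
  have [Q flowQ QI] := inv m (ltW t0) PI.
  exists Q; first by exists m, P.
  by have [_ h] := mP Q flowQ; apply: h; rewrite aT.
have [P Pr hP] := IH (a + tau) T at0 (ltW bT).
have PI := reach_itv (ltW t0) P0I Pr.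
have [m mP] := step _ _ _ _ _ _ _ _ small (th01 j) PI wd mus xit a0 _ tht (thE j).
have [Q flowQ QI] := inv m (ltW t0) PI.
exists Q; first by exists m, P.
have [h _] := mP Q flowQ; apply: le_trans h.
rewrite (@Rintegral_chasles R a (a + tau) T) ?(ltW bT) ?lerDl ?(ltW t0)//.
  by rewrite lerD2l.
exact: integrable_payoff wd mus xit _ _ a0.
Qed.

End UpperBound.

(** * Lower bound on the value by glued closed loops *)

Section Gluing.
Context {R : realType}.

Lemma switching_glue M (b : R) (mu1 mu2 : R -> 'I_M) :
  switching mu1 -> switching mu2 ->
  switching (fun t => if t < b then mu1 t else mu2 t).
Proof.
move=> s1 s2 m.
have -> : `[0, +oo[%classic `&` (fun t => if t < b then mu1 t else mu2 t) @^-1` [set m] =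
    ((`[0, +oo[ `&` mu1 @^-1` [set m]) `&` `]-oo, b[) `|`
    ((`[0, +oo[ `&` mu2 @^-1` [set m]) `&` `[b, +oo[) :> set R.
  apply/seteqP; split=> t /=; rewrite !in_itv /= !andbT; have [tb|bt] := ltP t b.
  - by move=> ?; left.
  - by move=> ?; right.
  - by case=> [[]|[]].
  - by case=> [[]|[]].
by apply: measurableU; apply: measurableI.
Qed.

Lemma mmeas_glue p q (E : set R) (b : R) (X Y : R -> 'M[R]_(p, q)) :
  measurable E -> mmeas E X -> mmeas E Y ->
  mmeas E (fun t => if t < b then X t else Y t).
Proof.
move=> mE mX mY i j.
rewrite (_ : (fun t => _) = fun t => if t < b then X t i j else Y t i j); last first.
  by apply/funext => t; case: ifP.
have mb : measurable_fun E (fun t : R => t < b) by exact: measurable_fun_ltr.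
apply: measurable_fun_if => //.
  by apply: measurable_funS (mX i j) => // t [].
by apply: measurable_funS (mY i j) => // t [].
Qed.

Lemma mbounded_glue p q (E : set R) (b : R) (X Y : R -> 'M[R]_(p, q)) :
  mbounded E X -> mbounded E Y -> mbounded E (fun t => if t < b then X t else Y t).
Proof.
move=> [c Xc] [d Yd]; exists (Num.max c d) => t Et i j.
by case: ifP => _; rewrite le_max ?Xc ?Yd ?orbT.
Qed.

End Gluing.

Section LowerBound.
Context {R : realType} {M n k : nat} (S : lq_data R M n k).
Notation leb := (@lebesgue_measure R).
Variables lambda eps delta2 : R.
Hypotheses (lambda_gt0 : 0 < lambda) (delta2_gt0 : 0 < delta2).
Notation I := (loewner_itv (eps%:M : 'M[R]_n) lambda%:M).
Hypothesis inv : forall (m : 'I_M) (t : R) (P0 : 'M[R]_n), 0 <= t -> I P0 ->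
  exists2 Q : 'M[R]_n, riccati_flow S m t P0 Q & I Q.
Hypothesis coercive : forall m P x, I P ->
  delta2 / 2 * enorm x ^+ 2 <= payoff_rate S m x (feedback S m P x).

Let beta : R := delta2 / lambda.

Let beta_gt0 : 0 < beta. Proof. by rewrite divr_gt0. Qed.

(** Coercivity and P <= lambda I bound the payoff rate below by [beta] times the current form. That
    form is the remaining payoff plus the terminal form, hence at least the terminal form; integrate
    over the step. *)
Lemma closed_loop_decay m P0 T P x w mu xi a s :
  I P0 -> riccati_solution S m P0 T P ->
  disturbance w -> switching mu -> trajectory S x w mu xi ->
  0 <= a -> 0 <= s -> (s%:E < T)%E ->
  (forall t, a <= t < a + s -> mu t = m) ->
  (forall t, a <= t < a + s -> w t = feedback S m (P (a + s - t)) (xi t)) ->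
  beta * s * (2^-1 * qform P0 (xi (a + s))) <=
    \int[leb]_(t in `[a, a + s]) payoff_rate S (mu t) (xi t) (w t).
Proof.
move=> P0I solP wd mus xit a0 s0 sT muE wE.
have abE : a <= a + s by rewrite lerDl.
set q := 2^-1 * _.
have rate t : a <= t < a + s ->
    beta * (2^-1 * qform (P (a + s - t)) (xi t)) <= payoff_rate S (mu t) (xi t) (w t) /\
    0 <= payoff_rate S (mu t) (xi t) (w t).
  move=> tab; have /andP[aT tb] := tab.
  have PI : I (P (a + s - t)).
    apply: (riccati_solution_itv inv P0I solP); first by rewrite subr_ge0 ltW.
    by apply: le_lt_trans sT; rewrite lee_fin; lra.
  rewrite muE// wE//; have := coercive m (xi t) PI.
  have [_ _ /(_ (xi t))] := PI; rewrite qform_scalar => h1 h2.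
  have e0 : 0 <= enorm (xi t) ^+ 2 by exact: sqr_ge0.
  split; apply: le_trans h2; last by rewrite mulr_ge0// divr_ge0// ltW.
  have : beta * qform (P (a + s - t)) (xi t) <= beta * (lambda * enorm (xi t) ^+ 2).
    by rewrite ler_wpM2l// ltW.
  rewrite mulrA [beta * lambda]divfK ?gt_eqF//; lra.
rewrite (_ : beta * s * q = beta * q * (a + s - a)); last by ring.
apply: ge_Rintegral => //; first exact: integrable_payoff wd mus xit _ _ a0.
move=> t tab; have [h _] := rate t tab; apply: le_trans h.
have /andP[aT tb] := tab.
rewrite ler_wpM2l ?(ltW beta_gt0)//.
have tab' : a <= t <= a + s by rewrite aT ltW.
have E := closed_loop_payoff solP wd mus xit a0 s0 sT tab'.
rewrite -E; last first.
- by move=> u /andP[tu ub]; apply: wE; rewrite ub (le_trans aT).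
- by move=> u /andP[tu ub]; apply: muE; rewrite ub (le_trans aT).
rewrite lerDr -(mul0r (a + s - t)); apply: ge_Rintegral; first exact: ltW.
  exact: integrable_payoff wd mus xit _ _ (le_trans a0 aT).
by move=> u /andP[tu ub]; have [] := rate u; rewrite ?ub ?(le_trans aT).
Qed.

(** Gains are glued rather than disturbances, because the disturbance depends on the state and is
    built once, at the end. The estimate is stated for every trajectory that agrees with the gains
    on the interval, so it applies to the tail of a longer one. *)
Lemma lower_chain (tau : R) (P0 : 'M[R]_n) (m0 : 'I_M) : 0 < tau -> I P0 ->
  forall j Q a, 0 <= a -> reach S tau P0 j Q ->
  exists mu K, [/\ switching mu, mmeas `[0, +oo[ K, mbounded `[0, +oo[ K &
    forall x w mu' xi, disturbance w -> switching mu' -> trajectory S x w mu' xi ->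
    (forall t, a <= t < a + j%:R * tau ->
       mu' t = mu t /\ w t = feedback S (mu t) (K t) (xi t)) ->
    (1 - (1 + beta * tau) ^- j) * (2^-1 * qform Q (xi a)) <=
      \int[leb]_(t in `[a, a + j%:R * tau]) payoff_rate S (mu' t) (xi t) (w t)].
Proof.
move=> tau0 P0I; elim=> [|j IH] Q a a0.
  move=> _; exists (fun=> m0), (fun=> 0); split.
  - exact: switching_cst.
  - exact: mmeas_cst.
  - by exists 0 => t _ i l; rewrite mxE normr0.
  move=> x w mu' xi _ _ _ _.
  by rewrite mul0r addr0 set_itv1 Rintegral_set1 expr0 invr1 subrr mul0r.
move=> /= [m [P [Pr flowQ]]].
have PI := reach_itv inv (ltW tau0) P0I Pr.
have QI := riccati_flow_itv inv (ltW tau0) PI flowQ.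
have [T [Psol [[solP _] tT PsolQ]]] := flowQ.
have at0 : 0 <= a + tau by rewrite addr_ge0// ltW.
have [mu [K [mus mK bK h]]] := IH P (a + tau) at0 Pr.
exists (fun t => if t < a + tau then m else mu t).
exists (fun t => if t < a + tau then riccati_gain Psol a tau t else K t); split.
- by apply: switching_glue => //; exact: switching_cst.
- by apply: mmeas_glue => //; exact: (riccati_gain_mmeas solP a0 (ltW tau0) tT).
- by apply: mbounded_glue => //; exact: (riccati_gain_mbounded solP a (ltW tau0) tT).
move=> x w mu' xi wd mu's xit agree.
have jt : 0 <= j%:R * tau by rewrite mulr_ge0// ltW.
have endE : a + j.+1%:R * tau = a + tau + j%:R * tau by rewrite -natr1; ring.
rewrite endE in agree *.
have muE t : a <= t < a + tau -> mu' t = m.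
  move=> /andP[aT tb]; have [] := agree t; first by rewrite aT/=; lra.
  by rewrite tb.
have wE t : a <= t < a + tau -> w t = feedback S m (Psol (a + tau - t)) (xi t).
  move=> /andP[aT tb]; have [] := agree t; first by rewrite aT/=; lra.
  by rewrite tb riccati_gainE ?aT ?ltW.
have pay := closed_loop_payoff solP wd mu's xit a0 (ltW tau0) tT _ muE wE.
have decay := closed_loop_decay PI solP wd mu's xit a0 (ltW tau0) tT muE wE.
have {}pay := pay _; rewrite addrAC subrr add0r PsolQ in pay.
have {}pay := pay _; rewrite lexx lerDl (ltW tau0) in pay; have {}pay := pay isT.
have tail := h x w mu' xi wd mu's xit.
have {}tail := tail _.
have {}tail : (1 - (1 + beta * tau) ^- j) * (2^-1 * qform P (xi (a + tau))) <=
    \int[leb]_(t in `[a + tau, a + tau + j%:R * tau]) payoff_rate S (mu' t) (xi t) (w t).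
  apply: tail => t /andP[aT tb]; have [] := agree t.
    by rewrite tb (le_trans _ aT)// lerDl ltW.
  by rewrite ltNge aT.
rewrite (@Rintegral_chasles R a (a + tau)) ?lerDl ?(ltW tau0)//; last first.
  exact: integrable_payoff wd mu's xit _ _ a0.
set p := 2^-1 * qform P _ in pay decay tail *.
set q := 2^-1 * qform Q _ in pay *.
set J1 := \int[leb]_(t in `[a, a + tau]) _ in pay decay *.
set J2 := \int[leb]_(t in _) _ in tail *.
pose r := 1 + beta * tau.
have r0 : 0 < r by rewrite addr_gt0// mulr_gt0.
have rp : r * p <= q by rewrite /r; lra.
have th0 : 0 <= (1 + beta * tau) ^- j by rewrite invr_ge0 exprn_ge0// ltW.
(* The step gives [q = J1 + p] with [J1 >= beta tau p], so the form shrinks by the factor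
   [1 + beta tau]. The two payoffs then sum to at least [q] minus the left-hand side. *)
have key : (1 + beta * tau) ^- j * p <= (1 + beta * tau) ^- j.+1 * q.
  have -> : (1 + beta * tau) ^- j.+1 = (1 + beta * tau) ^- j * r^-1.
    by rewrite exprSr invfM.
  by rewrite -[leRHS]mulrA ler_wpM2l// ler_pdivlMl.
lra.
Qed.

Lemma lower_bound (tau : R) P0 j Q x : 0 < tau -> I P0 -> (0 < j)%N ->
  reach S tau P0 j Q ->
  (((1 - (1 + beta * tau) ^- j) * (2^-1 * qform Q x))%:E <= value S x)%E.
Proof.
(* With at least one step the horizon is positive, as [value] requires, and the last flow supplies a
   mode. *)
move=> tau0 P0I; case: j => // j _ Qr.
have [m0 _] := Qr.
have [mu [K [mus mK bK h]]] := lower_chain m0 tau0 P0I (lexx 0) Qr.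
have [xi [wd xit]] := closed_loop_trajectory S x mus mK bK.
have jt : 0 < j.+1%:R * tau by rewrite mulr_gt0.
have := h _ _ _ _ wd mus xit.
rewrite add0r (trajectory0 xit) => {}h.
apply: (@le_trans _ _ (running_payoff S
  (fun t => feedback S (mu t) (K t) (xi t)) mu xi (j.+1%:R * tau))).
  by rewrite (running_payoffE wd mus xit (ltW jt)) lee_fin; apply: h.
apply: ereal_sup_ubound; exists (fun t => feedback S (mu t) (K t) (xi t)), mu, xi.
by exists (j.+1%:R * tau).
Qed.

End LowerBound.

(** * Convergence rate *)

Section Iteration.
Context {R : realType} {M n k : nat} (S : lq_data R M n k).
Variables lambda eps tau : R.
Hypotheses (eps_gt0 : 0 < eps) (lambda_gt0 : 0 < lambda) (tau_gt0 : 0 < tau).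
Notation I := (loewner_itv (eps%:M : 'M[R]_n) lambda%:M).
Hypothesis inv : forall (m : 'I_M) (t : R) (P0 : 'M[R]_n), 0 <= t -> I P0 ->
  exists2 Q : 'M[R]_n, riccati_flow S m t P0 Q & I Q.
Variable P0 : 'M[R]_n.
Hypothesis P0I : I P0.
Notation U j := (iter j (semigroup_sup S tau) (quad P0)).

(** Together with [iter_le_reach] this makes the iterate the pointwise supremum of the reached
    forms. *)
Lemma reach_le_iter j Q x : reach S tau P0 j Q -> (quad Q x <= U j x)%E.
Proof.
elim: j Q x => [|j IH] Q x /=; first by move=> ->.
move=> [m [P [Pr [T [Psol [[solP _] tT <-]]]]]].
have [w [xi [wd xit E]]] := riccati_payoff_attained solP x (ltW tau_gt0) tT.
apply: (@le_trans _ _ (semigroup S m tau (U j) x)); last first.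
  by apply: ereal_sup_ubound; exists m.
apply: (@le_trans _ _ (running_payoff S w (fun=> m) xi tau + U j (xi tau))%E).
  rewrite (running_payoffE wd (@switching_cst R M m) xit (ltW tau_gt0)).
  by rewrite /quad -E EFinD leeD2l// IH.
by apply: ereal_sup_ubound; exists w, xi.
Qed.

(** Quantifying over [x] and [c] lets the induction work at the end point of a step, with the
    running payoff moved into the bound. *)
Lemma iter_le_reach j x (c : R) :
  (forall Q, reach S tau P0 j Q -> 2^-1 * qform Q x <= c) -> (U j x <= c%:E)%E.
Proof.
elim: j x c => [|j IH] x c Qc /=; first by rewrite /quad lee_fin Qc.
apply: ge_ereal_sup => _ [m _ <-]; apply: ge_ereal_sup => _ [w [xi [wd xit ->]]].
rewrite (running_payoffE wd (@switching_cst R M m) xit (ltW tau_gt0)).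
rewrite addeC -leeBrDr// -EFinB; apply: IH => P Pr.
have PI := reach_itv inv (ltW tau_gt0) P0I Pr.
have [Q flowQ _] := inv m (ltW tau_gt0) PI.
have [T [Psol [[solP _] tT PsolQ]]] := flowQ.
rewrite lerBrDl (le_trans (riccati_payoff_le solP wd xit (ltW tau_gt0) tT))//.
by rewrite PsolQ; apply: Qc; exists m, P.
Qed.

Lemma reach_nonempty (m : 'I_M) j : exists Q, reach S tau P0 j Q.
Proof.
elim: j => [|j [P Pr]]; first by exists P0.
have PI := reach_itv inv (ltW tau_gt0) P0I Pr.
by have [Q flowQ _] := inv m (ltW tau_gt0) PI; exists Q; exists m, P.
Qed.

End Iteration.

Section ConvergenceRate.
Context {R : realType}.

Lemma expn_le_expR (r c : R) N : 0 <= r -> r <= expR (- c) ->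
  r ^+ N <= expR (- (c * N%:R)).
Proof.
move=> r0 rc; rewrite -mulNr expRM_natr.
by rewrite lerXn2r// nnegrE// expR_ge0.
Qed.

Lemma inv1D_le_expR (u : R) : 0 <= u <= 1 -> (1 + u)^-1 <= expR (- (u / 2)).
Proof.
move=> /andP[u0 u1]; apply: (@le_trans _ _ (1 - u / 2)); last exact: expR_ge1Dx.
have u1' : 0 < 1 + u by lra.
rewrite -[leLHS]mul1r ler_pdivrMr//; nra.
Qed.

(* The step tau is proportional to eta; N tau = O(- ln eta) makes both
   geometric errors at most eta^2. *)
Lemma step_size_choice (kappa beta beta' l tau0 : R) :
  0 < kappa -> 0 < beta -> 0 < beta' -> 0 < l -> 0 < tau0 ->
  beta * tau0 <= 1 -> kappa * tau0 <= 1 ->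
  exists C eta0 : R, [/\ 0 < C, 0 < eta0 < 1 &
  forall eta, 0 < eta <= eta0 -> exists (tau : R) (N : nat),
    [/\ 0 < tau <= tau0, (1 <= N)%N, N%:R <= C * (- ln eta / eta),
        theta_up kappa beta tau N * (2^-1 * l) <= eta &
        (1 + beta' * tau) ^- N * (2^-1 * l) <= eta]].
Proof.
move=> k0 b0 b'0 l0 t00 bt kt.
(* A common exponential rate; half of [beta'] is lost when [(1 + u)^-1] is bounded by an
   exponential. *)
pose b := Num.min beta (beta' / 2).
have bp : 0 < b by rewrite lt_min b0 divr_gt0.
have bb : b <= beta by rewrite ge_min lexx.
have bb' : b <= beta' / 2 by rewrite ge_min lexx orbT.
have lk : 0 < l * kappa by rewrite mulr_gt0.
(* The four thresholds give, in order, [- ln eta >= 1], [eta l <= 1], [tau <= tau0] and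
   [beta' tau <= 1]. *)
pose eta0 := Num.min (Num.min (expR (-1)) l^-1)
   (Num.min (tau0 * (l * kappa)) (l * kappa / beta')).
have e00 : 0 < eta0.
  by rewrite !lt_min expR_gt0 invr_gt0 l0 (mulr_gt0 t00 lk) divr_gt0.
(* The first term is the coefficient of the real number of steps [y]; the [+ 1] pays for rounding
   up, since [- ln eta / eta >= 1]. *)
exists (2 * (l * kappa) / b + 1), eta0; split.
- by rewrite addr_gt0// divr_gt0// mulr_gt0.
- have e0e : eta0 <= expR (-1) by rewrite !ge_min lexx.
  have e1 : expR (-1) < 1 :> R by rewrite expR_lt1 oppr_lt0.
  by rewrite e00 (le_lt_trans e0e).
move=> eta /andP[e0]; rewrite !le_min => /andP[/andP[e1 e2] /andP[e3 e4]].
have lne : 1 <= - ln eta.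
  by rewrite lerNr -[leRHS](@expRK R) ler_ln ?posrE ?expR_gt0.
have el1 : eta <= 1.
  by apply: (le_trans e1); rewrite expR_le1 oppr_le0.
(* This makes the floor [kappa tau] of the relaxation contribute exactly [eta / 2], and leaves the
   other half to the geometric term. *)
pose tau := eta / (l * kappa).
have t0 : 0 < tau by rewrite divr_gt0.
have tt0 : tau <= tau0 by rewrite ler_pdivrMr.
have b't : beta' * tau <= 1.
  by rewrite /tau mulrA ler_pdivrMr// mul1r mulrC -ler_pdivlMr.
have btau : beta * tau <= 1 by apply: le_trans bt; rewrite ler_wpM2l// ltW.
have ktau : kappa * tau <= 1 by apply: le_trans kt; rewrite ler_wpM2l// ltW.
pose y := 2 * - ln eta / (b * tau).
have bt0 : 0 < b * tau by rewrite mulr_gt0.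
have y0 : 0 <= y by apply: divr_ge0 (ltW bt0); lra.
pose N := (Num.truncn y).+1.
have yN : y <= N%:R by rewrite ltW// truncnS_gt.
have Ny : N%:R <= y + 1 by rewrite -natr1 lerD2r truncn_le.
have bN : 2 * - ln eta <= b * tau * N%:R.
  by rewrite [leRHS]mulrC -ler_pdivrMr.
have E2 : expR (- (b * tau * N%:R)) <= eta ^+ 2.
  rewrite -[in leRHS](@lnK R eta) ?posrE// -expRM_natr ler_expR lerNl.
  by rewrite -mulrN mulrC; move: bN; rewrite mulrN; lra.
have E3 : eta ^+ 2 * l <= eta.
  rewrite expr2 -mulrA ler_piMr ?(ltW e0)//.
  by rewrite -ler_pdivlMr// mul1r.
exists tau, N; split=> //; first by rewrite t0.
- apply: (le_trans Ny); rewrite mulrDl lerD//; last first.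
    by rewrite mul1r ler_pdivlMr// mul1r (le_trans el1).
  rewrite le_eqVlt; apply/orP; left; apply/eqP.
  by rewrite /y /tau; field; rewrite !gt_eqF.
- have h1 : (1 - beta * tau) ^+ N <= eta ^+ 2.
    apply: le_trans E2; apply: expn_le_expR; first by rewrite subr_ge0.
    apply: (le_trans (expR_ge1Dx _)).
    by rewrite ler_expR lerN2 ler_wpM2r// ltW.
  have h2 : (1 - kappa * tau) * (1 - beta * tau) ^+ N <= eta ^+ 2.
    apply: le_trans h1; rewrite ler_piMl ?exprn_ge0 ?subr_ge0//.
    by rewrite lerBlDr lerDl mulr_ge0// ltW.
  have h3 : kappa * tau * l = eta by rewrite /tau; field; rewrite !gt_eqF.
  have h4 : (1 - kappa * tau) * (1 - beta * tau) ^+ N * l <= eta.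
    by apply: le_trans E3; rewrite ler_wpM2r// ltW.
  by rewrite /theta_up; lra.
have h1 : (1 + beta' * tau) ^- N <= eta ^+ 2.
  apply: le_trans E2; rewrite -exprVn; apply: expn_le_expR.
    by rewrite invr_ge0 addr_ge0// mulr_ge0// ltW.
  apply: (@le_trans _ _ (expR (- (beta' * tau / 2)))).
    by apply: inv1D_le_expR; rewrite b't mulr_ge0// ltW.
  by rewrite ler_expR lerN2 mulrAC ler_wpM2r// ltW.
have h2 : (1 + beta' * tau) ^- N * l <= eta.
  by apply: le_trans E3; rewrite ler_wpM2r// ltW.
lra.
Qed.

End ConvergenceRate.

Section Core.
Context {R : realType} {M n k : nat} (S : lq_data R M n k).
Variables lambda lambda' eps delta delta2 : R.
Hypotheses (eps_gt0 : 0 < eps) (lambda_gt0 : 0 < lambda) (ltl : lambda < lambda').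
Hypotheses (delta_gt0 : 0 < delta) (delta2_gt0 : 0 < delta2).
Notation I := (loewner_itv (eps%:M : 'M[R]_n) lambda%:M).
Hypothesis inv : forall (m : 'I_M) (t : R) (P0 : 'M[R]_n), 0 <= t -> I P0 ->
  exists2 Q : 'M[R]_n, riccati_flow S m t P0 Q & I Q.
Hypothesis super : forall m x,
  qform (riccati_field S m lambda'%:M) x <= - delta * enorm x ^+ 2.
Hypothesis coercive : forall m P x, I P ->
  delta2 / 2 * enorm x ^+ 2 <= payoff_rate S m x (feedback S m P x).

Lemma value_iter_rate (m0 : 'I_M) : exists C eta0 : R, [/\ 0 < C, 0 < eta0 < 1 &
  forall eta, 0 < eta <= eta0 -> exists (tau : R) (N : nat),
    [/\ 0 < tau, (1 <= N)%N, N%:R <= C * (- ln eta / eta) &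
      forall P0, I P0 -> forall x,
        (`|value S x - iter N (semigroup_sup S tau) (quad P0) x|
           <= (eta * enorm x ^+ 2)%:E)%E]].
Proof.
have l'0 := lt_trans lambda_gt0 ltl.
have [tau0 [kappa [t00 k0 kt bt up]]] :=
  upper_bound eps_gt0 lambda_gt0 ltl delta_gt0 inv super.
have [C [eta0 [C0 e0 choice]]] := step_size_choice k0 (divr_gt0 delta_gt0 l'0)
  (divr_gt0 delta2_gt0 lambda_gt0) l'0 t00 bt kt.
exists C, eta0; split=> // eta etaP.
have [tau [N [taut N1 NC thU thL]]] := choice eta etaP.
have [t0 tt0] := andP taut.
exists tau, N; split=> // P0 P0I x.
have [Q0 Q0r] := reach_nonempty t0 inv P0I m0 N.
have low Q (Qr : reach S tau P0 N Q) :=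
  lower_bound lambda_gt0 delta2_gt0 inv coercive x t0 P0I N1 Qr.
have x0 : 0 <= enorm x ^+ 2 by exact: sqr_ge0.
have Qb Q : reach S tau P0 N Q -> 0 <= qform Q x <= lambda' * enorm x ^+ 2.
  move=> Qr; have QI := reach_itv inv (ltW t0) P0I Qr.
  rewrite (itv_qform_ge0 eps_gt0 x QI) /=.
  have [_ _ /(_ x)] := QI; rewrite qform_scalar => /le_trans; apply.
  by rewrite ler_wpM2r// ltW.
(* Finiteness of the value and of the iterate is settled beforehand, so that their difference is one
   of real numbers. *)
have vub : (value S x <= (2^-1 * (lambda' * enorm x ^+ 2))%:E)%E.
  apply: ge_ereal_sup => _ [w [mu [xi [T [wd mus xit T0 ->]]]]].
  rewrite (running_payoffE wd mus xit (ltW T0)) lee_fin -(trajectory0 xit).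
  exact: (super_payoff lambda_gt0 ltl delta_gt0 super wd mus xit (lexx 0) (ltW T0)).
have iub : (iter N (semigroup_sup S tau) (quad P0) x <=
    (2^-1 * (lambda' * enorm x ^+ 2))%:E)%E.
  apply: (iter_le_reach t0 inv P0I) => Q /Qb /andP[_ Ql].
  by rewrite ler_wpM2l.
have ilb Q := @reach_le_iter _ _ _ _ S tau t0 P0 N Q x.
set it := iter N _ _ x in iub ilb *.
have [r itr] : exists r, it = r%:E.
  exists (fine it); apply/esym/fineK; rewrite fin_numElt; apply/andP; split.
    by apply: lt_le_trans (ilb Q0 Q0r); exact: ltNyr.
  by apply: le_lt_trans iub _; exact: ltry.
have Qr Q : reach S tau P0 N Q -> 2^-1 * qform Q x <= r.
  by move=> /ilb; rewrite itr /quad lee_fin.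
have th0 : 0 <= theta_up kappa (delta / lambda') tau N.
  rewrite /theta_up addr_ge0 ?mulr_ge0 ?exprn_ge0 ?subr_ge0 ?(ltW k0) ?(ltW t0)//.
    by apply: le_trans kt; rewrite ler_wpM2l// ltW.
  by apply: le_trans bt; rewrite ler_wpM2l// ltW// divr_gt0.
have vup : (value S x <= (r + eta * enorm x ^+ 2)%:E)%E.
  apply: ge_ereal_sup => _ [w [mu [xi [T [wd mus xit T0 ->]]]]].
  rewrite (running_payoffE wd mus xit (ltW T0)) lee_fin.
  have [Q Qreach] := up tau taut P0 x w mu xi N 0 T P0I wd mus xit (lexx 0) (ltW T0).
  rewrite (trajectory0 xit) => /le_trans; apply.
  have /andP[q0 _] := Qb Q Qreach; have qr := Qr Q Qreach.
  have h1 := mulr_ge0 th0 q0.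
  have h2 := ler_wpM2r x0 thU.
  lra.
have vlo : ((r - eta * enorm x ^+ 2)%:E <= value S x)%E.
  have [v vE] : exists v, value S x = v%:E.
    exists (fine (value S x)); apply/esym/fineK; rewrite fin_numElt; apply/andP; split.
      by apply: lt_le_trans (low Q0 Q0r); exact: ltNyr.
    by apply: le_lt_trans vub _; exact: ltry.
  rewrite vE lee_fin lerBlDr -lee_fin -itr.
  (* Each reached form is at most the value plus a small multiple of itself; bounding that multiple
     through [lambda'] before taking the maximum gives an error independent of [Q]. *)
  apply: (iter_le_reach t0 inv P0I) => Q Qreach.
  have := low Q Qreach; rewrite vE lee_fin.
  have /andP[q0 q1] := Qb Q Qreach.
  have h2 := ler_wpM2r x0 thL.
  have h3 : 0 <= (1 + delta2 / lambda * tau) ^- N.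
    by rewrite invr_ge0 exprn_ge0// addr_ge0// mulr_ge0// ltW// divr_gt0.
  have h4 := ler_wpM2l h3 q1.
  lra.
rewrite itr; case: (value S x) vup vlo => [v| |] //=.
rewrite !lee_fin => h1 h2; rewrite ler_norml; apply/andP; split; lra.
Qed.

End Core.

(** * Slack and coercivity constants from (A1) and (A2) *)

Section Constants.
Context {R : realType} {M n k : nat} (S : lq_data R M n k).
Variables cA cs cD mD lambda eps : R.
Hypotheses (A1 : assumption_A1 S cA cs cD) (A2 : assumption_A2 S cA cs cD mD).
Hypothesis lambdaP : lambda1 S cA cs cD <= lambda < lambda2 S cs mD.

Let g : R := (lq_gamma S ^+ 2)^-1.
(** By (A1) the Riccati field at [z I] is at most [s z^2 - 2 cA z + cD] times the identity. The
    roots are [(cA - r) / s], which is [lambda1], and [(cA + r) / s]; in these terms [lambda2] is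
    the square root of [mD / s]. *)
Let s : R := cs ^+ 2 * g.
Let r : R := Num.sqrt (cA ^+ 2 - cD * s).

Let cA_gt0 : 0 < cA. Proof. by case: A1. Qed.
Let cD_gt0 : 0 < cD. Proof. by case: A1. Qed.
Let cs_gt0 : 0 < cs. Proof. by case: A1. Qed.
Let mD_gt0 : 0 < mD. Proof. by case: A2. Qed.
Let g_gt0 : 0 < g. Proof. by rewrite invr_gt0 exprn_gt0// lq_gamma_gt0. Qed.
Let s_gt0 : 0 < s. Proof. by rewrite mulr_gt0// exprn_gt0. Qed.

Let disc_gt0 : 0 < cA ^+ 2 - cD * s.
Proof. by rewrite subr_gt0 /s mulrA; case: A1. Qed.

Let r_gt0 : 0 < r. Proof. by rewrite sqrtr_gt0. Qed.

Let r_sqr : r ^+ 2 = cA ^+ 2 - cD * s. Proof. by rewrite sqr_sqrtr// ltW. Qed.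

Let r_lt : r < cA.
Proof.
rewrite -ltr_sqr ?nnegrE ?ltW// r_sqr ltrBlDr ltrDl.
by rewrite mulr_gt0.
Qed.

Let lambda1_le : cA - r <= s * lambda.
Proof.
have /andP[+ _] := lambdaP; rewrite /lambda1 -!/g.
rewrite -[X in Num.sqrt (_ - X)]mulrA -/s -/r ler_pdivrMr ?exprn_gt0//.
move=> h; rewrite /s /g mulrAC ler_pdivlMr ?exprn_gt0 ?lq_gamma_gt0//.
by rewrite mulrC [cs ^+ 2 * _]mulrC.
Qed.

Lemma lambda_gt0 : 0 < lambda.
Proof.
have : 0 < s * lambda by apply: lt_le_trans lambda1_le; rewrite subr_gt0.
by rewrite pmulr_rgt0.
Qed.

Let lambda2_lt : s * lambda ^+ 2 < mD.
Proof.
have /andP[_] := lambdaP; rewrite /lambda2 => h.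
have : lambda ^+ 2 < mD * lq_gamma S ^+ 2 / cs ^+ 2.
  rewrite -[ltRHS]sqr_sqrtr.
    by rewrite ltr_sqr ?nnegrE ?sqrtr_ge0// ltW// lambda_gt0.
  by rewrite divr_ge0 ?sqr_ge0// mulr_ge0 ?sqr_ge0// ltW.
rewrite ltr_pdivlMr ?exprn_gt0// => {}h.
by rewrite /s /g mulrAC ltr_pdivrMr ?exprn_gt0 ?lq_gamma_gt0// mulrC.
Qed.

Lemma sigma_tr_bound m (x : 'cV[R]_n) :
  dot ((lq_sigma S m)^T *m x) ((lq_sigma S m)^T *m x) <= cs ^+ 2 * dot x x.
Proof.
apply: dot_tr_bound => // v; apply: opnorm_bound.
by have [_ _ _ /(_ m)[]] := A1.
Qed.

Lemma payoff_rate_coercive : 0 < eps -> exists2 delta2, 0 < delta2 &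
  forall m (P : 'M[R]_n) x, loewner_itv eps%:M lambda%:M P ->
  delta2 / 2 * enorm x ^+ 2 <= payoff_rate S m x (feedback S m P x).
Proof.
(* The running reward is at least [mD / 2] and the feedback costs at most [s lambda^2 / 2], both
   times |x|^2; the difference is positive because [lambda < lambda2]. *)
move=> e0; exists (mD - s * lambda ^+ 2) => [|m P x PI]; first by rewrite subr_gt0.
have [symP _ Pl] := PI.
have P0 : loewner_le 0 P by move=> z; rewrite qform_eq0 (itv_qform_ge0 e0 z PI).
have h1 := loewner_sqr x symP lambda_gt0 P0 Pl.
have h2 := sigma_tr_bound m (P *m x).
have h3 : mD * enorm x ^+ 2 <= qform (lq_D S m) x by have [_ + _] := A2; apply.
have h4 : cs ^+ 2 * dot (P *m x) (P *m x) <= cs ^+ 2 * (lambda ^+ 2 * dot x x).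
  by rewrite ler_wpM2l// sqr_ge0.
have h5 := ler_wpM2l (ltW g_gt0) (le_trans h2 h4).
rewrite /payoff_rate /feedback !enorm_sqr -/g dotZl dotZr.
rewrite enorm_sqr in h3.
set v := dot _ (_ *m (P *m x)) in h5 *.
have -> : lq_gamma S ^+ 2 / 2 * (g * (g * v)) = 2^-1 * (g * v).
  by rewrite /g; field; rewrite gt_eqF// lq_gamma_gt0.
rewrite /s; lra.
Qed.

Lemma qform_riccati_field_scalar m z (x : 'cV[R]_n) :
  0 <= z -> qform (riccati_field S m z%:M) x <=
    (s * z ^+ 2 - 2 * cA * z + cD) * enorm x ^+ 2.
Proof.
move=> z0; rewrite qform_riccati_field ?symmetric_scalar// !mul_scalar_mx -!scalemxAr.
rewrite !(dotZl, dotZr) -qformE qform_tr.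
have [_ _ _ /(_ m)[hA _ _ hD] _] := A1.
have h1 := hA x; have h2 := hD x; have h3 := sigma_tr_bound m x.
have h4 := ler_wpM2l z0 h1.
have z2 : 0 <= g * (z * z) by rewrite mulr_ge0 ?mulr_ge0// ltW.
have h5 := ler_wpM2l z2 h3.
rewrite -(enorm_sqr x) in h5; rewrite -/g.
set v := dot _ _ in h5 *.
rewrite /s; lra.
Qed.

Lemma super_solution (m0 : 'I_M) : exists lambda' delta : R,
  [/\ lambda < lambda', 0 < delta & forall m (x : 'cV[R]_n),
    qform (riccati_field S m lambda'%:M) x <= - delta * enorm x ^+ 2].
Proof.
(* Dimension 0 is separate: comparing [mD] with [cD] takes a nonzero vector. *)
have [n0|n0] := posnP n.
  exists (lambda + 1), 1; split=> [||m x]; rewrite ?ltrDl//.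
  have -> : x = 0 by apply/matrixP => i; have := ltn_ord i; rewrite {2}n0.
  by rewrite /qform mulmx0 mxE enorm_sqr /dot mulmx0 mxE mulr0.
have mDcD : mD <= cD.
  pose e : 'cV[R]_n := delta_mx (Ordinal n0) 0.
  have [_ _ _ /(_ m0)[_ _ _ hD] _] := A1; have [_ hmD _] := A2.
  have := le_trans (hmD m0 e) (hD e).
  by rewrite enorm_delta !mulr1.
(* [lambda] lies left of the vertex [cA / s]: (s lambda)^2 < s mD <= s cD < cA^2. *)
have sl : s * lambda < cA.
  have sl0 : 0 <= s * lambda by rewrite mulr_ge0// ltW// lambda_gt0.
  rewrite -ltr_sqr ?nnegrE ?(ltW cA_gt0)//.
  have h1 : s * (s * lambda ^+ 2) < s * mD by rewrite ltr_pM2l.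
  have h2 : s * mD <= s * cD by rewrite ler_pM2l.
  have h3 := disc_gt0.
  have -> : (s * lambda) ^+ 2 = s * (s * lambda ^+ 2) by ring.
  lra.
(* The midpoint between [lambda] and the vertex. Its distance to the vertex is at most half of
   [r / s], so it lies strictly between the two roots. *)
pose l' := (lambda + cA / s) / 2.
have sl' : s * l' = (s * lambda + cA) / 2 by rewrite /l'; field; rewrite gt_eqF.
have ll' : lambda < l' by rewrite -(ltr_pM2l s_gt0) sl'; lra.
pose d := - (s * l' ^+ 2 - 2 * cA * l' + cD).
have d0 : 0 < d.
  have : 0 < s * d.
    have -> : s * d = r ^+ 2 - (cA - s * l') ^+ 2 by rewrite r_sqr /d; ring.
    have h4 := lambda1_le; have h5 := r_gt0.
    by rewrite subr_gt0 ltr_sqr ?nnegrE ?(ltW r_gt0)// sl'; lra.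
  by rewrite pmulr_rgt0.
exists l', d; split=> // m x.
have := qform_riccati_field_scalar m x (ltW (lt_trans lambda_gt0 ll')).
by rewrite /d opprK.
Qed.

End Constants.
Unset Implicit Arguments.
Set Strict Implicit.

Theorem corollary7p1 (R : realType) (ops : nat -> nat -> nat -> nat)
    (Hops : cost_model R ops) :
  exists2 K : R, 0 < K &
  forall (M n k : nat) (S : lq_data R M n k) (cA cs cD mD lambda eps : R),
    assumption_A1 S cA cs cD ->
    assumption_A2 S cA cs cD mD ->
    lambda1 S cA cs cD <= lambda < lambda2 S cs mD ->
    0 < eps ->
    (exists (t0 : R) (m : 'I_M) (Q : 'M[R]_n),
        [/\ 0 < t0, riccati_flow S m t0 0 Q & loewner_le eps%:M Q]) ->
    (forall (m : 'I_M) (t : R) (P0 : 'M[R]_n), 0 <= t ->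
        loewner_itv eps%:M lambda%:M P0 ->
        exists2 Q : 'M[R]_n,
          riccati_flow S m t P0 Q & loewner_itv eps%:M lambda%:M Q) ->
    exists C C' eta0 : R,
      [/\ 0 < C, 0 < C', 0 < eta0 < 1 &
      forall eta : R, 0 < eta <= eta0 ->
      exists (tau : R) (N : nat),
        [/\ 0 < tau,
            (1 <= N)%N,
            N%:R <= C * (- ln eta / eta),
            (forall P0 : 'M[R]_n, loewner_itv eps%:M lambda%:M P0 ->
             forall x : 'cV[R]_n,
               (`|value S x - iter N (semigroup_sup S tau) (quad P0) x|
                <= (eta * enorm x ^+ 2)%:E)%E) &
            (ops M n N)%:R <=
              K * M%:R `^ (C' * (- ln eta / eta)) * n%:R ^+ 3]].
Proof.
have [c c0 opsc] := Hops.
(* The cost constant is fixed before the data, hence uniform in them. Condition (i) supplies a mode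
   [m0]. *)
exists c => // M n k S cA cs cD mD lambda eps A1 A2 lambdaP eps0 [t0 [m0 _]] inv.
have l0 := lambda_gt0 A1 lambdaP.
have [lambda' [delta [ltl d0 super]]] := super_solution A1 A2 lambdaP m0.
have [delta2 d20 coercive] := payoff_rate_coercive A1 A2 lambdaP eps0.
have [C [eta0 [C0 e0 rate]]] := value_iter_rate eps0 l0 ltl d0 d20 inv super coercive m0.
exists C, C, eta0; split=> // eta etaP.
have [tau [N [tau0 N1 NC err]]] := rate eta etaP.
exists tau, N; split=> //.
apply: (le_trans (opsc M n N)); rewrite ler_wpM2r ?exprn_ge0//.
(* The bound on [N] is moved into the exponent, which is monotone since the existence of [m0] gives
   [M >= 1]; hence the same constant serves as [C] and [C']. *)
rewrite ler_wpM2l ?(ltW c0)// -powR_mulrn// ler_powR//.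
by rewrite ler1n; apply: leq_ltn_trans (ltn_ord m0).
Qed.
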